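(* Let $a\colon \mathbb{N}_0 \to \mathbb{C}$ be an automatic sequence and let $p \in \mathbb{Z}[x]$ be a nonconstant polynomial with $p(\mathbb{N}_0) \subset \mathbb{N}_0$. Then, for any totally ergodic measure-preserving system $(X,\mu,T)$ and any $f \in L^2(\mu)$ with $\int_X f \, d\mu = 0$, we have $$\mathbb{E}_{n<N}\, a(n)\, T^{p(n)} f \to 0 \quad \text{in } L^2(\mu) \text{ as } N \to \infty.$$
   Context: $\mathbb{N}=\{1,2,\dots\}$, $\mathbb{N}_0=\mathbb{N}\cup\{0\}$, and $\mathbb{E}_{n<N}\,x(n)=\frac1N\sum_{n=0}^{N-1}x(n)$. Automatic sequences: for an integer $k\ge 2$ let $\Sigma_k=\{0,\dots,k-1\}$ and let $\Sigma_k^*$ be the set of finite words over $\Sigma_k$ (including the empty word). For $n\in\mathbb{N}_0$, $(n)_k\in\Sigma_k^*$ is the base-$k$ expansion of $n$ without leading zeros, most significant digit on the left ($(0)_k$ is the empty word). A $k$-automaton $(S,s_0,\delta,\tau)$ consists of a finite set of states $S$, an initial state $s_0\in S$, a transition function $\delta\colon S\times\Sigma_k\to S$ and an output function $\tau\colon S\to\Delta$. Extend $\delta$ to $S\times\Sigma_k^*$ by $\delta(s,\text{empty word})=s$ and $\delta(s,uv)=\delta(\delta(s,v),u)$ (so the rightmost digit is read first). A sequence $a\colon\mathbb{N}_0\to\Delta$ is $k$-automatic if $a(n)=\tau(\delta(s_0,(n)_k))$ for some $k$-automaton, and automatic if it is $k$-automatic for some $k\ge2$. A measure-preserving system $(X,\mu,T)$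 is a probability space $(X,\mu)$ with a $\mu$-preserving map $T\colon X\to X$; $(Tf)(x)=f(Tx)$ and $(T^nf)(x)=f(T^nx)$. The system is totally ergodic if $T^n$ is ergodic for every $n\in\mathbb{N}$. *)

(* Defs.v *)
From HB Require Import structures.
From mathcomp Require Import all_boot all_order all_algebra.
From mathcomp Require Import complex.
From mathcomp Require Import all_classical all_reals all_analysis.

Set Implicit Arguments.
Unset Strict Implicit.
Unset Printing Implicit Defensive.

Import Order.TTheory GRing.Theory Num.Theory.
Import numFieldNormedType.Exports.

Local Open Scope classical_set_scope.
Local Open Scope ring_scope.

(* Words are sequences of digits, most significant digit first. As
   [up_log k n.+1] is the least [L] with [n < k ^ L], the expansion below has
   no leading zeros, and the expansion of [0] is the empty word. *)
Definition base_expansion (k : nat) (k_gt1 : (1 < k)%N) (n : nat) : seq 'I_k :=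
  [seq Ordinal (ltn_pmod (n %/ k ^ i)%N (ltnW k_gt1))
     | i <- rev (iota 0 (up_log k n.+1))].

Definition word_value (k : nat) (m : nat) (w : seq 'I_k) : nat :=
  foldl (fun v (d : 'I_k) => v * k + d)%N m w.

Lemma rev_iota0S (L : nat) : rev (iota 0 L.+1) = L :: rev (iota 0 L).
Proof. by rewrite -[X in iota 0 X]addn1 iotaD add0n rev_cat. Qed.

Lemma modn_expS (n k L : nat) : (0 < k)%N ->
  (n %% k ^ L.+1 = (n %/ k ^ L %% k) * k ^ L + n %% k ^ L)%N.
Proof.
move=> k0; have kL0 : (0 < k ^ L)%N by rewrite expn_gt0 k0.
rewrite {1}(divn_eq n (k ^ L)) {1}(divn_eq (n %/ k ^ L) k) expnS.
rewrite mulnDl -mulnA -addnA modnMDl modn_small//.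
rewrite (@leq_trans ((n %/ k ^ L %% k).+1 * k ^ L)%N)//.
  by rewrite mulSn addnC ltn_add2r ltn_mod.
by rewrite leq_mul2r ltn_mod k0 orbT.
Qed.

Lemma base_expansionK (k : nat) (k_gt1 : (1 < k)%N) (n : nat) :
  word_value 0 (base_expansion k_gt1 n) = n.
Proof.
suff H (L m : nat) :
    word_value m [seq Ordinal (ltn_pmod (n %/ k ^ i)%N (ltnW k_gt1))
      | i <- rev (iota 0 L)] = (m * k ^ L + n %% k ^ L)%N.
  by rewrite H mul0n add0n modn_small// up_logP.
elim: L m => [|L IH] m; first by rewrite /= expn0 muln1 modn1 addn0.
rewrite rev_iota0S /= IH modn_expS ?(ltnW k_gt1)//.
by rewrite expnS mulnDl -mulnA addnA.
Qed.

Lemma base_expansion_no_leading0 (k : nat) (k_gt1 : (1 < k)%N) (n : nat)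
    (d : 'I_k) (w : seq 'I_k) :
  base_expansion k_gt1 n = d :: w -> (0 < d)%N.
Proof.
rewrite /base_expansion; case L0 : (up_log k n.+1) => [//|L].
rewrite rev_iota0S /= => -[<- _] /=.
have n_gt0 : (0 < n)%N by case: n L0 => //; rewrite up_log1.
have kL0 : (0 < k ^ L)%N by rewrite expn_gt0 ltnW.
rewrite modn_small.
  by rewrite divn_gt0// -ltnS -[L]/(L.+1.-1) -L0 up_log_gtn.
by rewrite ltn_divLR// -expnS -L0 up_logP.
Qed.

Record automaton (k : nat) (D : Type) := Automaton {
  state : finType;
  init : state;
  trans : state -> 'I_k -> state;
  output : state -> D }.

(* [foldr] consumes the rightmost (least significant) digit first. *)
Definition trans_word (k : nat) (D : Type) (M : automaton k D)
    (s : state M) (w : seq 'I_k) : state M :=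
  foldr (fun d s' => trans s' d) s w.

Lemma trans_word_cat (k : nat) (D : Type) (M : automaton k D) (s : state M)
    (u v : seq 'I_k) :
  trans_word s (u ++ v) = trans_word (trans_word s v) u.
Proof. exact: foldr_cat. Qed.

Definition k_automatic (k : nat) (k_gt1 : (1 < k)%N) (D : Type)
    (a : nat -> D) : Prop :=
  exists M : automaton k D,
    forall n, a n = output (trans_word (init M) (base_expansion k_gt1 n)).

Definition automatic (D : Type) (a : nat -> D) : Prop :=
  exists (k : nat) (k_gt1 : (1 < k)%N), k_automatic k_gt1 a.

Definition measure_preserving (R : realType) (d : measure_display)
    (X : measurableType d) (mu : probability X R) (T : X -> X) : Prop :=
  measurable_fun [set: X] T /\
  forall A : set X, measurable A -> mu (T @^-1` A) = mu A.

Definition ergodic (R : realType) (d : measure_display)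
    (X : measurableType d) (mu : probability X R) (T : X -> X) : Prop :=
  forall A : set X, measurable A -> T @^-1` A = A ->
    mu A = 0%E \/ mu A = 1%E.

Definition totally_ergodic (R : realType) (d : measure_display)
    (X : measurableType d) (mu : probability X R) (T : X -> X) : Prop :=
  forall n : nat, (0 < n)%N -> ergodic mu (iter n T).

(* Complex-valued functions: measurability and integration are componentwise,
   as the library only integrates (extended-)real-valued functions. Elements
   of L^2 are handled through representatives. *)
Definition cmeasurable (R : realType) (d : measure_display)
    (X : measurableType d) (f : X -> R[i]) : Prop :=
  measurable_fun [set: X] (fun x => complex.Re (f x)) /\
  measurable_fun [set: X] (fun x => complex.Im (f x)).

Definition L2norm (R : realType) (d : measure_display)
    (X : measurableType d) (mu : probability X R) (f : X -> R[i]) : \bar R :=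
  ('N[mu]_2%:E[(fun x => (Normc.normc (f x))%:E)])%E.

Definition inL2 (R : realType) (d : measure_display)
    (X : measurableType d) (mu : probability X R) (f : X -> R[i]) : Prop :=
  cmeasurable f /\ (L2norm mu f < +oo)%E.

Definition cintegral (R : realType) (d : measure_display)
    (X : measurableType d) (mu : probability X R) (f : X -> R[i]) : R[i] :=
  Complex (\int[mu]_x (complex.Re (f x))) (\int[mu]_x (complex.Im (f x))).

Definition cvgL2 (R : realType) (d : measure_display)
    (X : measurableType d) (mu : probability X R)
    (u : nat -> X -> R[i]) (g : X -> R[i]) : Prop :=
  (L2norm mu (fun x => u N x - g x) @[N --> \oo] --> 0%E).

(* At [N = 0] the empty average is [0]. *)
Definition average (C : fieldType) (N : nat) (x : nat -> C) : C :=
  N%:R^-1 * \sum_(0 <= n < N) x n.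

(* Main.v *)
Require Import Defs.
From mathcomp Require Import all_boot all_order all_algebra.
From mathcomp Require Import complex.
From mathcomp Require Import all_classical all_reals all_analysis.
From mathcomp Require Import measurable_realfun cyclic separable cyclotomic.
From mathcomp Require Import zify ring lra.

(** The squared norm of the average is a quadratic form in the
    autocorrelations of [f], and autocorrelations are mixtures of characters
    [z ^ j] with [z] on the unit circle. So everything reduces to the
    exponential sums [S_N z = N^-1 * \sum_(n < N) a n * z ^ p.[n]], provided
    that the bounds on them are uniform enough in [z].

    Uniformity over the whole circle fails: at a root of unity [S_N] need not
    tend to [0]. But total ergodicity says that the spectral measure of [f]
    has no atom there. By the mean ergodic theorem ([mean_ergodic]) for
    [T ^ q], the average [M^-1 * \sum_(m < M) z ^ (q * m)] is small in mean
    square for the spectral measure when [M] is large, although its modulus is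
    at least [1/2] when [z ^ q] is within [1/(2M)] of [1]. For each [q] some
    small neighbourhood of the [q]-th roots of unity thus has as little
    spectral mass as desired. It is enough that [S_N] be uniformly small once
    finitely many such neighbourhoods are removed, where the radius for each
    [q] is prescribed in advance but the number of orders [q] to remove is
    free. This is the notion [negligible], and [polynomial_negligible] proves
    it for automatic [a] and nonconstant [p].

    When [p] is linear, split [n] into digits: the inner sums over blocks of
    [k ^ L] consecutive integers are products of [L] averaging operators on
    functions of the state ([word_average]), each of norm at most [1] for the
    supremum norm. Grouping digits makes them more numerous than the states
    ([kernel_family_expn]); then two digits lead from any given state to the
    same state, and the corresponding two terms cancel in part unless a fixed
    power of the current [z ^ (k ^ j)] is close to [1]. As raising to the
    power [k] expands near [1], these powers stay close to [1] through a long
    window only if [z] is extremely close to a root of unity of an order that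
    was known before the window began. Hence every sufficiently long window
    gains a fixed factor ([word_average_minor]). Higher degrees follow by van
    der Corput's inequality, since correlations of an automatic sequence are
    automatic and differencing lowers the degree.

    Herglotz's theorem is used in a finitary form, with measures on the [M]-th
    roots of unity as [M] grows ([toeplitz_form_spectral]); the inequality
    between exponential sums is then an inequality between quadratic forms
    ([toeplitz_form_le]). Real and imaginary parts of [a] and [f] are treated
    separately, so that these forms are real. *)

Set Implicit Arguments.
Unset Strict Implicit.
Unset Printing Implicit Defensive.

Import Order.TTheory GRing.Theory Num.Theory.
Import numFieldNormedType.Exports.

Local Open Scope ring_scope.

(** * Moduli of complex numbers *)

Section ComplexModulus.
Context {R : realType}.
Implicit Types z u v : R[i].
Local Notation nc := (@Normc.normc R).

Lemma normc_ge0 z : 0 <= nc z.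
Proof. by case: z => a b; rewrite /Normc.normc sqrtr_ge0. Qed.

Lemma sqr_normcE z : nc z ^+ 2 = complex.Re z ^+ 2 + complex.Im z ^+ 2.
Proof. by case: z => a b; rewrite /Normc.normc sqr_sqrtr// addr_ge0// sqr_ge0. Qed.

Lemma normc_realE (x : R) : nc (real_complex R x) = `|x|.
Proof. by rewrite /Normc.normc /= expr0n /= addr0 sqrtr_sqr. Qed.

Lemma normcX z n : nc (z ^+ n) = nc z ^+ n.
Proof.
elim: n => [|n IH]; first by rewrite !expr0 Normc.normc1.
by rewrite !exprS Normc.normcM IH.
Qed.

Lemma unit_normcX z n : nc z = 1 -> nc (z ^+ n) = 1.
Proof. by move=> z1; rewrite normcX z1 expr1n. Qed.

Lemma unit_neq0 z : nc z = 1 -> z != 0.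
Proof. by apply: contra_eq_neq => ->; rewrite Normc.normc0 eq_sym oner_eq0. Qed.

Lemma normc_sum (I : Type) (r : seq I) (P : pred I) (F : I -> R[i]) :
  nc (\sum_(i <- r | P i) F i) <= \sum_(i <- r | P i) nc (F i).
Proof.
elim/big_rec2: _ => [|i x y Pi le_xy]; first by rewrite Normc.normc0.
by rewrite (le_trans (le_normcD _ _))// lerD2l.
Qed.

Lemma normc_natr n : nc n%:R = n%:R.
Proof. by rewrite -(rmorph_nat (real_complex R)) normc_realE normr_nat. Qed.

Lemma normc_sumW n (F : nat -> R[i]) (W : R) :
  (forall i, (i < n)%N -> nc (F i) <= W) -> nc (\sum_(i < n) F i) <= n%:R * W.
Proof.
move=> FW; apply: (le_trans (normc_sum _ _ _)).
rewrite mulr_natl -[in leRHS](card_ord n) -sumr_const.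
by apply: ler_sum => i _; exact: FW.
Qed.

Lemma normc_subX_le u n : nc u = 1 -> nc (u ^+ n - 1) <= n%:R * nc (u - 1).
Proof.
move=> u1; rewrite subrX1 Normc.normcM mulrC ler_wpM2r ?normc_ge0//.
rewrite -[leRHS]mulr1; apply: normc_sumW => i _.
by rewrite unit_normcX.
Qed.

Lemma normcB_sym u v : nc (u - v) = nc (v - u).
Proof. by rewrite -normcN opprB. Qed.

(** Parallelogram law: if two unit vectors are apart, then their sum is
    noticeably shorter than [2]. *)
Lemma normc_add1_le u (c : R) : nc u = 1 -> 0 <= c <= nc (u - 1) ->
  nc (1 + u) <= 2 - c ^+ 2 / 4.
Proof.
move=> u1 /andP[c0 cu].
have par : nc (1 + u) ^+ 2 + nc (u - 1) ^+ 2 = 4.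
  have := sqr_normcE u; rewrite u1 !sqr_normcE; case: u {u1 cu} => a b /=; nra.
have := normc_ge0 (1 + u); have := normc_ge0 (u - 1) => ? ?.
have c2 : c ^+ 2 <= nc (u - 1) ^+ 2 by rewrite ler_sqr ?nnegrE.
have c4 : c ^+ 2 <= 4.
  by apply: (le_trans c2); rewrite -par lerDr sqr_ge0.
rewrite -ler_sqr ?nnegrE//; nra.
Qed.

(** The quotient [(u ^+ k - 1) / (u - 1)] is a sum of [k] powers of [u], each
    close to [1], so that the power map expands near [1]. *)
Lemma normc_subX_ge u k : (3 < k)%N -> nc u = 1 ->
  nc (u - 1) <= (k%:R ^+ 2)^-1 -> 2 * nc (u - 1) <= nc (u ^+ k - 1).
Proof.
move=> k3 u1 small; rewrite subrX1 Normc.normcM mulrC ler_wpM2l ?normc_ge0//.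
have k0 : 0 < k%:R :> R by rewrite ltr0n; lia.
have k4 : 4 <= k%:R :> R by rewrite (ler_nat _ 4); lia.
have dev : nc (\sum_(i < k) u ^+ i - k%:R) <= 1.
  have -> : \sum_(i < k) u ^+ i - k%:R = \sum_(i < k) (u ^+ i - 1).
    by rewrite big_split/= sumrN sumr_const card_ord.
  apply: (@le_trans _ _ (k%:R * (k%:R * nc (u - 1)))).
    apply: (@normc_sumW k (fun i => u ^+ i - 1)) => i ik; apply: le_trans (normc_subX_le i u1) _.
    by rewrite ler_wpM2r ?normc_ge0// ler_nat ltnW.
  by rewrite mulrA -expr2 -ler_pdivlMl ?exprn_gt0// mulr1.
have := le_normcD (\sum_(i < k) u ^+ i) (k%:R - \sum_(i < k) u ^+ i).
rewrite addrC subrK normc_natr normcB_sym => h.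
lra.
Qed.

(** Iterated expansion: staying close to [1] for [l] steps forces [u] to be
    exponentially close to [1] at the start. *)
Lemma normc_sub_expand u k l : (3 < k)%N -> nc u = 1 ->
  (forall j, (j < l)%N -> nc (u ^+ (k ^ j) - 1) <= (k%:R ^+ 2)^-1) ->
  2 ^+ l * nc (u - 1) <= nc (u ^+ (k ^ l) - 1).
Proof.
move=> k3 u1; elim: l => [|l IH] small; first by rewrite expr0 mul1r expn0 expr1.
rewrite exprS -mulrA expnSr exprM.
apply: le_trans (normc_subX_ge k3 (unit_normcX _ u1) (small l (ltnSn l))).
by rewrite ler_pM2l// IH// => j jl; apply: small; rewrite ltnS ltnW.
Qed.

End ComplexModulus.

(** * Contraction of digit averages away from roots of unity *)

(** In the circle method, the complement of the neighbourhoods of the rational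
    points of small denominator. The distance is measured after raising to the
    power [q], which treats all the [q]-th roots of unity at once. *)
Definition minor_arc (R : realType) (eta : nat -> R) (B : nat) (z : R[i]) :=
  forall q : nat, (0 < q <= B)%N -> eta q <= Normc.normc (z ^+ q - 1).

(** The radii [eta] are given before the bound [B] on the orders: the spectral
    mass near the [q]-th roots of unity can be made small for each [q], but at
    a scale depending on [q] over which there is no control. *)
Definition negligible (R : realType) (F : nat -> R[i] -> R[i]) :=
  forall eta : nat -> R, (forall q, 0 < eta q) -> forall e : R, 0 < e ->
  exists B N0 : nat, forall N z, (N0 <= N)%N -> Normc.normc z = 1 ->
    minor_arc eta B z -> Normc.normc (F N z) <= e.

(** The [F s] are the sequences that an automaton produces from its states
    [s], reading the lowest digit first; a sequence belongs to such a family
    exactly when its [k]-kernel is finite. The condition [0 < m] is there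
    because expansions have no leading zeros: one-digit numbers are not
    constrained. *)
Definition kernel_family (R : realType) (k : nat) (S : finType)
    (step : S -> nat -> S) (C : R) (F : S -> nat -> R) :=
  (forall s n, `|F s n| <= C) /\
  (forall s m d, (0 < m)%N -> (d < k)%N -> F s (m * k + d)%N = F (step s d) m).

(** The transfer operator of one digit. *)
Definition digit_average (R : realType) (k : nat) (S : finType)
    (step : S -> nat -> S) (z : R[i]) (w : S -> R[i]) (s : S) : R[i] :=
  k%:R^-1 * \sum_(d < k) z ^+ d * w (step s d).

(** At each step the digits weigh [k] times more, hence the change from [z] to
    [z ^+ k]. *)
Fixpoint word_average (R : realType) (k : nat) (S : finType)
    (step : S -> nat -> S) (L : nat) (z : R[i]) (w : S -> R[i]) : S -> R[i] :=
  if L is L'.+1 then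
    digit_average k step z (word_average k step L' (z ^+ k) w)
  else w.

Section Contraction.
Context {R : realType} (k : nat) (S : finType) (step : S -> nat -> S).
Context (k_gt3 : (3 < k)%N) (card_lt : (#|S| < k)%N).
Local Notation nc := (@Normc.normc R).
Implicit Types (z u : R[i]) (w : S -> R[i]) (W : R).

Local Notation eps := ((k%:R ^+ 2)^-1 : R).
(** Let [c = eps / k`!]. When [z ^+ k`!] is at distance at least [eps] from
    [1], each [z ^+ D] with [D] the difference of two digits is at distance at
    least [c], as [D] divides [k`!]; two colliding digits then shorten the sum
    of the [k] terms by [c ^+ 2 / 4]. *)
Definition contraction_gain : R := (eps / (k`!)%:R) ^+ 2 / (4 * k%:R).
Local Notation kappa := contraction_gain.

Let k_gt0 : 0 < k%:R :> R. Proof. by rewrite ltr0n (ltn_trans _ k_gt3). Qed.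

Lemma contraction_gain_bounds : 0 < kappa < 1.
Proof.
have k4 : 4 <= k%:R :> R by rewrite (ler_nat _ 4).
have f1 : 1 <= (k`!)%:R :> R by rewrite (ler_nat _ 1) fact_gt0.
have e1 : eps <= 1 by rewrite invf_le1 ?exprn_gt0// exprn_ege1//; lra.
have e0 : 0 < eps by rewrite invr_gt0 exprn_gt0.
have f0 : 0 < (k`!)%:R :> R by lra.
have q1 : eps / (k`!)%:R <= 1 by rewrite ler_pdivrMr// mul1r (le_trans e1).
have q0 : 0 < eps / (k`!)%:R by rewrite divr_gt0.
rewrite /kappa divr_gt0 ?exprn_gt0 ?mulr_gt0//= ltr_pdivrMr ?mulr_gt0//.
have := exprn_ile1 2 (ltW q0) q1; lra.
Qed.

Lemma digit_average_le z w W s : nc z = 1 -> (forall t, nc (w t) <= W) ->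
  nc (digit_average k step z w s) <= W.
Proof.
move=> z1 wW; rewrite /digit_average Normc.normcM Normc.normcV normc_natr.
rewrite ler_pdivrMl//.
apply: (@normc_sumW _ k (fun d => z ^+ d * w (step s d))) => d _.
by rewrite Normc.normcM unit_normcX// mul1r.
Qed.

(** With more digits than states, two digits lead from [s] to the same state.
    The factorial is a common multiple of all possible differences. *)
Lemma colliding_digits s : exists d e : 'I_k,
  [/\ (d < e)%N, step s d = step s e & (e - d %| k`!)%N].
Proof.
have /injectivePn [d [e ne eq]] : ~~ injectiveb (fun d : 'I_k => step s d).
  apply/negP => /injectiveP /leq_card; rewrite card_ord => h.
  by move: card_lt; rewrite ltnNge h.
wlog lt_de : d e ne eq / (d < e)%N => [hw|].
  have [lt|gt|/val_inj/eqP] := ltngtP d e; first exact: (hw d e).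
    by apply: (hw e d) => //; rewrite eq_sym.
  by rewrite (negbTE ne).
exists d, e; split=> //; apply: dvdn_fact; have := ltn_ord e; lia.
Qed.

(** The two colliding digits give [w t * (z ^+ d + z ^+ e)] for a common state
    [t], which is shorter than [2 * W] because [z ^+ (e - d)] is away from
    [1]. *)
Lemma digit_average_contract z w W s : nc z = 1 ->
  (forall t, nc (w t) <= W) -> eps <= nc (z ^+ k`! - 1) ->
  nc (digit_average k step z w s) <= (1 - kappa) * W.
Proof.
move=> z1 wW far; have W0 : 0 <= W by apply: le_trans (wW s); exact: normc_ge0.
have [d [e [lt_de eq_de dvd_de]]] := colliding_digits s.
rewrite /digit_average Normc.normcM Normc.normcV normc_natr ler_pdivrMl//.
set c := eps / (k`!)%:R.
have f0 : 0 < (k`!)%:R :> R by rewrite ltr0n fact_gt0.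
have c0 : 0 <= c by rewrite divr_ge0 ?invr_ge0 ?exprn_ge0 ?ltW.
have cle : c <= nc (z ^+ (e - d) - 1).
  rewrite /c ler_pdivrMr// mulrC; apply: (le_trans far).
  rewrite -{1}(divnK dvd_de) mulnC exprM.
  apply: le_trans (normc_subX_le _ (unit_normcX _ z1)) _.
  by rewrite ler_wpM2r ?normc_ge0// ler_nat leq_div.
rewrite (bigD1 d)//= (bigD1 e)/=; last by rewrite -val_eqE/= gtn_eqF.
rewrite addrA; apply: (le_trans (le_normcD _ _)).
have sumW : (2 - c ^+ 2 / 4) * W + (k - 2)%:R * W = k%:R * ((1 - kappa) * W).
  rewrite natrB; last by lia.
  by rewrite /kappa -/c; field; rewrite gt_eqF.
rewrite -sumW; apply: lerD.
  have -> : z ^+ e = z ^+ d * z ^+ (e - d) by rewrite -exprD subnKC// ltnW.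
  rewrite -eq_de -mulrDl -[X in X + _]mulr1 -mulrDr !Normc.normcM.
  rewrite unit_normcX// mul1r ler_pM ?normc_ge0//.
  by apply: normc_add1_le; rewrite ?unit_normcX// c0.
apply: (le_trans (normc_sum _ _ _)).
apply: (@le_trans _ _ (\sum_(i < k | (i != d) && (i != e)) W)).
  by apply: ler_sum => i _; rewrite Normc.normcM unit_normcX// mul1r.
rewrite sumr_const -[leLHS]mulr_natl ler_wpM2r// ler_nat.
have -> : #|[pred i : 'I_k | (i != d) && (i != e)]| = #|~: [set d; e]|.
  by apply: eq_card => i; rewrite !inE negb_or.
rewrite cardsCs finset.setCK cards2 card_ord.
by rewrite -val_eqE/= ltn_eqF.
Qed.

Lemma word_average_le L z w W s : nc z = 1 -> (forall t, nc (w t) <= W) ->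
  nc (word_average k step L z w s) <= W.
Proof.
elim: L z s => [|L IH] z s z1 wW /=; first exact: wW.
by apply: digit_average_le => // t; apply: IH; rewrite ?unit_normcX.
Qed.

Lemma word_averageD L L' z w :
  word_average k step (L + L') z w =
  word_average k step L z (word_average k step L' (z ^+ (k ^ L)) w).
Proof.
elim: L z => [|L IH] z; first by rewrite expn0 expr1.
by rewrite addSn /= IH -exprM -expnS.
Qed.

(** One digit position where [z ^+ k`!] has moved away from [1] is enough,
    since the averages over the other positions do not increase the supremum
    norm. *)
Lemma word_average_contract L z w W j s : nc z = 1 ->
  (forall t, nc (w t) <= W) -> (j < L)%N ->
  eps <= nc ((z ^+ k`!) ^+ (k ^ j) - 1) ->
  nc (word_average k step L z w s) <= (1 - kappa) * W.
Proof.
move=> z1 wW jL far; have -> : L = (j + (1 + (L - j.+1)))%N by lia.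
rewrite word_averageD; apply: word_average_le => // t /=.
apply: digit_average_contract; rewrite ?unit_normcX//.
  by move=> t'; apply: word_average_le; rewrite ?unit_normcX.
by rewrite -exprM mulnC exprM.
Qed.

(** Either some position of the window contracts, or the orbit of [z ^+ k`!]
    under the power map stays close to [1] throughout, which by expansion puts
    [z ^+ k`!] itself too close to [1]. *)
Lemma word_average_window (eta : R) z w W l s : 0 < eta ->
  nc z = 1 -> (forall t, nc (w t) <= W) -> eps < 2 ^+ l * eta ->
  eta <= nc (z ^+ k`! - 1) ->
  nc (word_average k step l.+1 z w s) <= (1 - kappa) * W.
Proof.
move=> eta0 z1 wW leta far.
have [[j [jl cj]]|near] := pselect (exists j : nat, (j < l.+1)%N /\
    eps <= nc ((z ^+ k`!) ^+ (k ^ j) - 1)); first exact: word_average_contract cj.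
have {}near j : (j <= l)%N -> nc ((z ^+ k`!) ^+ (k ^ j) - 1) <= eps.
  move=> jl; rewrite leNgt; apply/negP => lt; apply: near; exists j.
  by rewrite ltnS ltW.
have u1 := unit_normcX k`! z1.
have := normc_sub_expand k_gt3 u1 (fun j jl => near j (ltnW jl)).
move=> /le_trans /(_ (near l (leqnn l))) h.
have : 2 ^+ l * eta <= eps.
  by apply: le_trans h; rewrite ler_pM2l ?exprn_gt0.
by rewrite leNgt leta.
Qed.

(** The windows are chosen one after the other. The next one starts after [L]
    digits, where [z] has become [z ^+ (k ^ L)]; this determines the order
    [q = k ^ L * k`!], hence the radius [eta q], hence the length that the
    window needs in order to gain a factor. *)
Lemma word_average_minor (eta : nat -> R) J : (forall q, 0 < eta q) ->
  exists B L : nat, forall z w W s, nc z = 1 -> minor_arc eta B z ->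
    (forall t, nc (w t) <= W) ->
    nc (word_average k step L z w s) <= (1 - kappa) ^+ J * W.
Proof.
move=> eta0; elim: J => [|J [B [L IH]]].
  by exists 0%N, 0%N => z w W s _ _ wW; rewrite expr0 mul1r.
pose q := (k ^ L * k`!)%N.
have [l lP] : exists l, eps < 2 ^+ l * eta q.
  exists (Num.bound (eps / eta q)).
  by rewrite -ltr_pdivrMr// (upper_nthrootP (leqnn _)).
exists (maxn B q), (L + l.+1)%N => z w W s z1 good wW.
rewrite word_averageD exprSr -mulrA; apply: IH => //.
  by move=> q' /andP[q0 qB]; apply: good; rewrite q0 leq_max qB.
move=> t; apply: (word_average_window t (eta0 q) _ wW lP).
  exact: unit_normcX.
rewrite -exprM; apply: good; rewrite leq_maxr andbT muln_gt0 fact_gt0 andbT.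
by rewrite expn_gt0; lia.
Qed.

End Contraction.

(** * Block decomposition of automatic sums *)

Lemma big_ord_mul (V : nmodType) (m k : nat) (f : nat -> V) :
  \sum_(i < m * k) f i = \sum_(j < m) \sum_(d < k) f (j * k + d)%N.
Proof.
elim: m => [|m IH]; first by rewrite mul0n !big_ord0.
by rewrite mulSnr big_split_ord /= big_ord_recr /= IH.
Qed.

Section KernelFamily.
Context {R : realType}.
Local Notation nc := (@Normc.normc R).
Local Notation "x %:C" := (real_complex R x) (at level 1, format "x %:C").

(** Reading [l] digits at a time, the number of digits exceeds the number of
    states if [l] is large, at no cost in states. *)
Lemma kernel_family_expn (k : nat) (S : finType) (step : S -> nat -> S) (C : R)
    (F : S -> nat -> R) (l : nat) : (0 < k)%N -> kernel_family k step C F ->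
  exists step' : S -> nat -> S, kernel_family (k ^ l) step' C F.
Proof.
move=> k0 [FC Fk]; elim: l => [|l [step' [_ IH]]].
  exists (fun s _ => s); split=> // s m [|//] _ _.
  by rewrite expn0 muln1 addn0.
exists (fun s r => step' (step s (r %% k)%N) (r %/ k)%N); split=> // s m r m0 rk.
rewrite {1}(divn_eq r k) expnSr mulnA addnA -mulnDl Fk ?ltn_mod//.
  by rewrite IH// ltn_divLR// -expnSr.
by rewrite addn_gt0 muln_gt0 m0 expn_gt0 k0.
Qed.

Lemma kernel_family_block (k : nat) (S : finType) (step : S -> nat -> S) (C : R)
    (F : S -> nat -> R) (L m : nat) (z : R[i]) (s : S) : (0 < k)%N ->
  kernel_family k step C F -> (0 < m)%N ->
  \sum_(r < k ^ L) (F s (m * k ^ L + r)%N)%:C * z ^+ r =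
  (k ^ L)%:R * word_average k step L z (fun t => (F t m)%:C) s.
Proof.
move=> k0 [_ Fk] m0; elim: L z s => [|L IH] z s.
  by rewrite expn0 big_ord1 muln1 addn0 expr0 mulr1 mul1r.
rewrite expnSr (big_ord_mul _ _ (fun r => (F s (m * (k ^ L * k) + r)%N)%:C * z ^+ r)).
rewrite exchange_big /=.
have kn0 : k%:R != 0 :> R[i] by rewrite pnatr_eq0 -lt0n.
rewrite /digit_average natrM -mulrA mulVKf// mulr_sumr.
apply: eq_bigr => d _; rewrite mulrCA -IH mulr_sumr; apply: eq_bigr => r _.
rewrite mulnA addnA -mulnDl Fk//; last by rewrite addn_gt0 muln_gt0 m0 expn_gt0 k0.
by rewrite exprD [(r * k)%N]mulnC exprM mulrA mulrC.
Qed.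

(** The first block, where leading zeros would matter, and the last,
    incomplete one are estimated trivially. *)
Lemma kernel_family_sum_le (k : nat) (S : finType) (step : S -> nat -> S) (C : R)
    (F : S -> nat -> R) (L N : nat) (rho : R) (z : R[i]) (s : S) :
  (0 < k)%N -> kernel_family k step C F -> nc z = 1 -> 0 <= rho ->
  (forall m t, nc (word_average k step L z (fun t => (F t m)%:C) t) <= rho) ->
  nc (\sum_(n < N) (F s n)%:C * z ^+ n) <= N%:R * rho + 2 * ((k ^ L)%:R * C).
Proof.
move=> k0 Fk z1 rho0 wrho; have [FC _] := Fk.
have C0 : 0 <= C by apply: le_trans (FC s 0%N).
set P := (k ^ L)%N; have P0 : (0 < P)%N by rewrite expn_gt0 k0.
have term n : nc ((F s n)%:C * z ^+ n) <= C.
  by rewrite Normc.normcM unit_normcX// mulr1 normc_realE.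
rewrite -(big_mkord xpredT (fun n => (F s n)%:C * z ^+ n)).
rewrite {1}(divn_eq N P) big_mkord big_split_ord /=.
apply: (le_trans (le_normcD _ _)); rewrite [2 * _]mulr_natl mulr2n addrA.
apply: lerD; last first.
  apply: le_trans (normc_sumW (fun i _ => term _)) _.
  by rewrite ler_wpM2r// ler_nat ltnW// ltn_mod.
rewrite (big_ord_mul _ _ (fun n => (F s n)%:C * z ^+ n)).
case M : (N %/ P)%N => [|M'].
  by rewrite big_ord0 Normc.normc0 addr_ge0// mulr_ge0.
rewrite big_ord_recl; apply: (le_trans (le_normcD _ _)).
rewrite [leRHS]addrC; apply: lerD.
  apply: (@normc_sumW _ _ (fun d => (F s (0 * P + d)%N)%:C * z ^+ (0 * P + d))).
  by move=> d _; exact: term.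
apply: (@le_trans _ _ (M'%:R * (P%:R * rho))).
  apply: (@normc_sumW _ _ (fun i => \sum_(d < P)
    (F s (i.+1 * P + d)%N)%:C * z ^+ (i.+1 * P + d))) => i _.
  under eq_bigr do rewrite exprD mulrCA.
  rewrite -mulr_sumr Normc.normcM unit_normcX// mul1r (kernel_family_block _ _ _ k0 Fk)//.
  by rewrite Normc.normcM normc_natr ler_wpM2l.
rewrite mulrA -natrM ler_wpM2r// ler_nat.
have := leq_trunc_div N P; rewrite M; nia.
Qed.

End KernelFamily.

(** * Linear exponents *)

Section LinearExponents.
Context {R : realType}.
Local Notation nc := (@Normc.normc R).
Local Notation "x %:C" := (real_complex R x) (at level 1, format "x %:C").

Lemma expr_small (x e : R) : 0 <= x < 1 -> 0 < e -> exists J : nat, x ^+ J < e.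
Proof.
move=> /andP[x0 x1] e0.
have /cvgrPdist_lt /(_ _ e0) [J _ JP] : ((fun n => x ^+ n) @ \oo --> (0 : R))%classic.
  by apply: cvg_expr; rewrite ger0_norm.
exists J; have := JP J (leqnn J).
by rewrite sub0r normrN ger0_norm ?exprn_ge0.
Qed.

Lemma ltr_bound_nat (x : R) : exists n : nat, x < n%:R.
Proof.
exists (Num.bound `|x|); apply: le_lt_trans (ler_norm x) _.
exact: archi_boundP.
Qed.

(** Each window multiplies the block sums by a factor less than [1], uniformly
    on the minor arc; take enough windows, then [N] large against the block
    length. *)
Lemma kernel_family_negligible (k : nat) (S : finType) (step : S -> nat -> S)
    (C : R) (F : S -> nat -> R) (s : S) : (1 < k)%N -> kernel_family k step C F ->
  negligible (fun N z => N%:R^-1 * \sum_(n < N) (F s n)%:C * z ^+ n).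
Proof.
move=> k1 Fk eta eta0 e e0.
(* In this base there are more than [3] digits, and more digits than states. *)
have [step' Fk'] := kernel_family_expn (#|S|.+2) (ltnW k1) Fk.
set K := (k ^ #|S|.+2)%N in Fk'.
have SK : (#|S|.+2 < K)%N by rewrite /K ltn_expl.
have cS : (0 < #|S|)%N by apply/card_gt0P; exists s.
have K3 : (3 < K)%N by lia.
have C0 : 0 <= C by have [FC _] := Fk; apply: le_trans (FC s 0%N).
have [g0 g1] := andP (@contraction_gain_bounds R K K3).
have [J Jsmall] : exists J, (1 - contraction_gain K) ^+ J < e / (2 * (C + 1)) :> R.
  by apply: expr_small; [lra | rewrite divr_gt0// mulr_gt0//; lra].
have [B [L BL]] := @word_average_minor R K S step' K3 (ltnW (ltnW SK)) eta J eta0.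
have [N0 N0P] := ltr_bound_nat (2 * ((K ^ L)%:R * C) / (e / 2)).
exists B, (maxn 1 N0) => N z; rewrite geq_max => /andP[N1 N0N] z1 zB.
have N1' : 0 < N%:R :> R by rewrite ltr0n.
rewrite Normc.normcM Normc.normcV normc_natr ler_pdivrMl//.
have rho0 : 0 <= (1 - contraction_gain K) ^+ J * C :> R.
  by rewrite mulr_ge0// exprn_ge0//; lra.
have [FC _] := Fk.
apply: (le_trans (kernel_family_sum_le (L := L) N s _ Fk' z1 rho0 _)).
- by lia.
- move=> m t; apply: BL => // t'; rewrite normc_realE; exact: FC.
have -> : e = e / 2 + e / 2 by lra.
rewrite mulrDr; apply: lerD.
  rewrite ler_pM2l//; move: Jsmall; rewrite ltr_pdivlMr; last by lra.
  move: rho0; set x := (_ ^+ J); have : 0 <= x by rewrite exprn_ge0//; lra.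
  by nra.
move: N0P; rewrite ltr_pdivrMr; last by lra.
move=> /ltW /le_trans; apply; rewrite ler_wpM2r ?ler_nat//; lra.
Qed.

Lemma negligible_expr (F : nat -> R[i] -> R[i]) (c : nat) : (0 < c)%N ->
  negligible F -> negligible (fun N z => F N (z ^+ c)).
Proof.
move=> c0 nF eta eta0 e e0.
have [B [N0 h]] := nF (fun q => eta (q * c)%N) (fun q => eta0 _) e e0.
exists (B * c)%N, N0 => N z NN z1 zB; apply: h; rewrite ?unit_normcX// => q q0B.
rewrite -exprM mulnC; apply: zB; nia.
Qed.

Lemma negligible_inv (F : nat -> R[i] -> R[i]) :
  negligible F -> negligible (fun N z => F N z^-1).
Proof.
move=> nF eta eta0 e e0; have [B [N0 h]] := nF eta eta0 e e0.
exists B, N0 => N z NN z1 zB.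
apply: h; rewrite ?Normc.normcV ?z1 ?invr1// => q q0B.
have z0 := unit_neq0 z1.
rewrite exprVn; apply: le_trans (zB q q0B) _.
have -> : z ^- q - 1 = (1 - z ^+ q) * z ^- q.
  by rewrite mulrBl mulfV ?expf_neq0// mul1r.
by rewrite Normc.normcM Normc.normcV unit_normcX// invr1 mulr1 normcB_sym.
Qed.

Lemma negligible_le (F G : nat -> R[i] -> R[i]) :
  (forall N z, nc z = 1 -> nc (G N z) <= nc (F N z)) -> negligible F -> negligible G.
Proof.
move=> GF nF eta eta0 e e0; have [B [N0 h]] := nF eta eta0 e e0.
by exists B, N0 => N z NN z1 zB; apply: le_trans (GF _ _ z1) _; exact: h.
Qed.

Definition kernel_automatic (k : nat) (a : nat -> R) :=
  exists (S : finType) (step : S -> nat -> S) (C : R) (F : S -> nat -> R) (s : S),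
    kernel_family k step C F /\ a =1 F s.

Lemma kernel_automatic_bounded k a : kernel_automatic k a ->
  exists2 C : R, 0 < C & forall n, `|a n| <= C.
Proof.
move=> [S [step [C [F [s [[FC _] aF]]]]]].
exists (C + 1); first by have := FC s 0%N; have := normr_ge0 (F s 0%N); lra.
by move=> n; rewrite aF; have := FC s n; lra.
Qed.

Lemma kernel_automaticM k a b : kernel_automatic k a -> kernel_automatic k b ->
  kernel_automatic k (fun n => a n * b n).
Proof.
move=> [S [step [C [F [s [[FC Fk] aF]]]]]] [S' [step' [C' [F' [s' [[FC' Fk'] bF]]]]]].
exists (S * S')%type, (fun t d => (step t.1 d, step' t.2 d)), (C * C').
exists (fun t n => F t.1 n * F' t.2 n), (s, s'); split; last by move=> n; rewrite aF bF.
split=> [t n|t m d m0 dk] /=; last by rewrite Fk// Fk'.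
by rewrite normrM ler_pM.
Qed.

(** Adding [h] to the lowest digit leaves a carry of at most [h], which the
    new states remember. *)
Lemma kernel_automatic_shift k a h : (1 < k)%N -> kernel_automatic k a ->
  kernel_automatic k (fun n => a (n + h)%N).
Proof.
move=> k1 [S [step [C [F [s [[FC Fk] aF]]]]]].
exists (S * 'I_h.+1)%type.
exists (fun (t : S * 'I_h.+1) d =>
  (step t.1 ((d + t.2) %% k)%N, inord ((d + t.2) %/ k)%N)), C.
exists (fun (t : S * 'I_h.+1) n => F t.1 (n + t.2)%N), (s, ord_max).
split; last by move=> n; rewrite aF.
split=> [t n|t m d m0 dk] /=; first exact: FC.
have ch : ((d + t.2) %/ k < h.+1)%N.
  rewrite ltn_divLR ?(ltnW k1)//; have := ltn_ord t.2; nia.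
rewrite inordK// -addnA {1}(divn_eq (d + t.2) k) addnA -mulnDl Fk ?ltn_mod//.
  by rewrite addn_gt0 m0.
exact: ltnW.
Qed.

End LinearExponents.

(** * Van der Corput's inequality *)

Section VanDerCorput.
Context {R : realType}.
Local Notation nc := (@Normc.normc R).
Local Notation "x %:C" := (real_complex R x) (at level 1, format "x %:C").

Lemma mul_conjc (z : R[i]) : z * conjc z = (nc z ^+ 2)%:C.
Proof.
rewrite sqr_normcE; case: z => a b; simpc; apply/eqP; rewrite eq_complex /=.
by apply/andP; split; apply/eqP; ring.
Qed.

Lemma normc_conjc (z : R[i]) : nc (conjc z) = nc z.
Proof. by case: z => a b; rewrite /Normc.normc /= sqrrN. Qed.

(** Cauchy-Schwarz against a constant sequence. *)
Lemma sqr_sum_le (n : nat) (x : nat -> R) :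
  (\sum_(i < n) x i) ^+ 2 <= n%:R * \sum_(i < n) x i ^+ 2.
Proof.
elim: n => [|n IH]; first by rewrite !big_ord0 expr0n mulr0.
rewrite !big_ord_recr /= -natr1.
set s := \sum_(i < n) x i in IH *; set q := \sum_(i < n) x i ^+ 2 in IH *.
set y := x n.
have : 0 <= q - 2 * y * s + n%:R * y ^+ 2.
  have -> : q - 2 * y * s + n%:R * y ^+ 2 = \sum_(i < n) (x i - y) ^+ 2.
    rewrite (eq_bigr (fun i : 'I_n => x i ^+ 2 - 2 * y * x i + y ^+ 2)).
      by rewrite big_split/= sumrB -mulr_sumr sumr_const card_ord [n%:R * _]mulr_natl.
    by move=> i _; ring.
  by apply: sumr_ge0 => i _; exact: sqr_ge0.
nra.
Qed.

Lemma normc_shift_sum_le (u : nat -> R[i]) (C : R) (N h : nat) :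
  (forall n, nc (u n) <= C) ->
  nc (\sum_(n < N) u n - \sum_(n < N) u (n + h)%N) <= 2 * (h%:R * C).
Proof.
move=> uC.
have -> : \sum_(n < N) u n - \sum_(n < N) u (n + h)%N =
    \sum_(i < h) u i - \sum_(i < h) u (N + i)%N.
  apply/eqP; rewrite subr_eq -addrA [- _ + _]addrC addrA -subr_eq opprK; apply/eqP.
  transitivity (\sum_(i < N + h) u i); first by rewrite big_split_ord.
  rewrite addnC big_split_ord /=; congr (_ + _).
  by apply: eq_bigr => i _; rewrite addnC.
apply: (le_trans (le_normcD _ _)); rewrite normcN [2 * _]mulr_natl mulr2n.
apply: lerD; [apply: (@normc_sumW _ h u)|].
  by move=> i _; exact: uC.
by apply: (@normc_sumW _ h (fun i => u (N + i)%N)) => i _; exact: uC.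
Qed.

(** The sum is compared with sums over windows of length [H], whose mean
    square expands into correlations. The [H] diagonal ones contribute
    [C ^+ 2 / H]; the last term of the bound is the error made at both ends by
    sliding the window. *)
Lemma van_der_corput (u : nat -> R[i]) (C delta e : R) (N H : nat) :
  (0 < H)%N -> (forall n, nc (u n) <= C) -> 0 <= delta -> 0 <= e ->
  (forall h h' : nat, (h < H)%N -> (h' < H)%N -> h != h' ->
     nc (\sum_(n < N) u (n + h)%N * conjc (u (n + h')%N)) <= N%:R * delta) ->
  C ^+ 2 / H%:R + delta <= e ^+ 2 ->
  nc (\sum_(n < N) u n) <= N%:R * e + 2 * (H%:R * C).
Proof.
move=> H0 uC d0 e0 corr le_e2.
have C0 : 0 <= C by apply: le_trans (uC 0%N); exact: normc_ge0.
have H0' : 0 < H%:R :> R by rewrite ltr0n.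
pose w n := \sum_(h < H) u (n + h)%N.
(* By Cauchy-Schwarz in [n], then by expanding the squares. *)
have windows : nc (\sum_(n < N) w n) <= H%:R * (N%:R * e).
  apply: (le_trans (normc_sum _ _ _)).
  rewrite -ler_sqr ?nnegrE ?mulr_ge0 ?sumr_ge0// => [|i _]; last exact: normc_ge0.
  apply: (le_trans (sqr_sum_le _ (fun n => nc (w n)))).
  rewrite !exprMn mulrCA [N%:R ^+ 2]expr2 -mulrA ler_wpM2l//.
  have expand : (\sum_(n < N) nc (w n) ^+ 2)%:C =
      \sum_(h < H) \sum_(h' < H) \sum_(n < N) u (n + h)%N * conjc (u (n + h')%N).
    rewrite rmorph_sum /=.
    under eq_bigr do rewrite -mul_conjc /w raddf_sum mulr_suml.
    rewrite exchange_big /=; apply: eq_bigr => h _.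
    under eq_bigr do rewrite mulr_sumr.
    by rewrite exchange_big.
  have S0 : 0 <= \sum_(n < N) nc (w n) ^+ 2 by apply: sumr_ge0 => i _; exact: sqr_ge0.
  rewrite -[leLHS]ger0_norm// -normc_realE expand.
  apply: (@le_trans _ _ (H%:R * (N%:R * (C ^+ 2 + H%:R * delta)))); last first.
    rewrite [leLHS]mulrCA ler_wpM2l// [H%:R ^+ 2]expr2 -mulrA ler_wpM2l ?(ltW H0')//.
    have : H%:R * (C ^+ 2 / H%:R + delta) <= H%:R * e ^+ 2 by rewrite ler_pM2l.
    by rewrite mulrDr [X in X + _]mulrCA mulfV ?gt_eqF// mulr1.
  apply: (@normc_sumW _ _ (fun h => \sum_(h' < H) \sum_(n < N)
    u (n + h)%N * conjc (u (n + h')%N))) => h hH.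
  rewrite (bigD1 (Ordinal hH)) //= mulrDr.
  apply: (le_trans (le_normcD _ _)); apply: lerD.
    apply: (@normc_sumW _ _ (fun n => u (n + h)%N * conjc (u (n + h)%N))) => n _.
    rewrite Normc.normcM normc_conjc -expr2 ler_sqr ?nnegrE ?normc_ge0//.
  apply: (le_trans (normc_sum _ _ _)); rewrite [leRHS]mulrCA.
  apply: (@le_trans _ _ (\sum_(h' < H | h' != Ordinal hH) (N%:R * delta))).
    by apply: ler_sum => h' ne; apply: corr => //; rewrite eq_sym -val_eqE in ne.
  rewrite sumr_const -[leLHS]mulr_natl ler_wpM2r ?mulr_ge0// ler_nat.
  by rewrite -[leqRHS](card_ord H) max_card.
rewrite -(ler_pM2l H0') mulrDr.
have -> : H%:R * nc (\sum_(n < N) u n) = nc (\sum_(h < H) \sum_(n < N) u n).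
  by rewrite sumr_const card_ord -[in RHS]mulr_natl Normc.normcM normc_natr.
rewrite -[X in nc X](subrK (\sum_(n < N) w n)) [X in nc X]addrC.
apply: (le_trans (le_normcD _ _)); apply: lerD => //.
rewrite /w [X in _ - X]exchange_big /= -sumrB.
apply: (@normc_sumW _ _ (fun h => \sum_(n < N) u n - \sum_(n < N) u (n + h)%N)).
move=> h hH; apply: (le_trans (normc_shift_sum_le _ _ uC)).
by rewrite ler_pM2l// ler_wpM2r// ler_nat ltnW.
Qed.

End VanDerCorput.

(** * Polynomial exponents *)

Section PolynomialExponents.
Context {R : realType}.
Local Notation nc := (@Normc.normc R).
Local Notation "x %:C" := (real_complex R x) (at level 1, format "x %:C").

Lemma size_exp_XaddC (A : comNzRingType) (c : A) n :
  size (('X + c%:P) ^+ n) = n.+1.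
Proof. by rewrite -[c%:P]opprK -polyCN size_exp_XsubC. Qed.

Lemma coef_XaddC_expr (A : comNzRingType) (c : A) n :
  (('X + c%:P) ^+ n.+1)`_n = c *+ n.+1.
Proof.
elim: n => [|n IH]; first by rewrite expr1 coefD coefX coefC add0r.
rewrite exprSr mulrDr coefD coefMX coefMC /= IH.
have := monic_exp n.+1 (monicXaddC c).
rewrite monicE lead_coefE size_exp_XaddC /= => /eqP ->.
by rewrite mul1r -mulrSr.
Qed.

Lemma coef_XaddC_exprn (A : comNzRingType) (c : A) n :
  (('X + c%:P) ^+ n)`_n = 1.
Proof.
have := monic_exp n (monicXaddC c).
by rewrite monicE lead_coefE size_exp_XaddC /= => /eqP.
Qed.

(** The leading coefficients cancel, and in the next degree [n] remains
    [n.+1 * (c - c')] times the leading coefficient. *)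
Lemma size_translate_sub (A : idomainType) (p : {poly A}) (c c' : A) n :
  [pchar A] =i pred0 -> size p = n.+2 -> c != c' ->
  size ((p \Po ('X + c%:P)) - (p \Po ('X + c'%:P))) = n.+1.
Proof.
move=> char0 sp ne; set q := _ - _.
have coefs b i : (n <= i)%N -> (p \Po ('X + b%:P))`_i =
    if i == n then p`_n + p`_n.+1 * (b *+ n.+1) else p`_i.
  move=> ni; have [ni1|ni1] := leqP n.+2 i.
    rewrite gtn_eqF ?(ltnW ni1)//.
    by rewrite !nth_default ?sp// size_comp_poly2 ?size_XaddC// sp.
  rewrite coef_comp_poly sp !big_ord_recr /= big1 => [|j _]; last first.
    by rewrite [X in _ * X]nth_default ?mulr0// size_exp_XaddC (leq_trans _ ni).
  have : (i == n) || (i == n.+1) by lia.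
  case/orP => /eqP ->.
    by rewrite eqxx coef_XaddC_expr coef_XaddC_exprn add0r mulr1.
  rewrite gtn_eqF// coef_XaddC_exprn [X in p`_n * X]nth_default ?size_exp_XaddC//.
  by rewrite mulr0 !add0r mulr1.
have qn : q`_n != 0.
  rewrite coefB !coefs// eqxx opprD addrACA subrr add0r -mulrBr -mulrnBl.
  rewrite mulf_neq0//; first by have := lead_coef_eq0 p; rewrite lead_coefE sp /= => ->;
    rewrite -size_poly_eq0 sp.
  by rewrite -mulr_natr mulf_neq0 ?subr_eq0// ((pcharf0P A).1 char0).
apply/anti_leq/andP; split.
  apply/leq_sizeP => i ni; rewrite coefB !coefs ?(ltnW ni)//.
  by rewrite gtn_eqF// subrr.
by rewrite ltnNge; apply: contra qn => le; rewrite nth_default.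
Qed.

Lemma negligible_family (I : finType) (P : pred I) (F : I -> nat -> R[i] -> R[i])
    (eta : nat -> R) (e : R) :
  (forall i, P i -> negligible (F i)) -> (forall q, 0 < eta q) -> 0 < e ->
  exists B N0 : nat, forall i N z, P i -> (N0 <= N)%N -> nc z = 1 ->
    minor_arc eta B z -> nc (F i N z) <= e.
Proof.
move=> nF eta0 e0.
have /choice[f fP] : forall i, exists BN : nat * nat, P i -> forall N z,
    (BN.2 <= N)%N -> nc z = 1 -> minor_arc eta BN.1 z -> nc (F i N z) <= e.
  move=> i; have [Pi|nPi] := boolP (P i); last by exists (0, 0)%N.
  by have [B [N0 h]] := nF i Pi eta eta0 e e0; exists (B, N0).
exists (\max_i (f i).1), (\max_i (f i).2) => i N z Pi NN z1 zB.
apply: fP => //; first by rewrite (leq_trans _ NN)// leq_bigmax.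
move=> q /andP[q0 qB]; apply: zB.
by rewrite q0 (leq_trans qB)// (leq_bigmax (F := fun i => (f i).1)).
Qed.

Lemma unit_normcXz (z : R[i]) (j : int) : nc z = 1 -> nc (z ^ j) = 1.
Proof.
move=> z1; case: j => n; first exact: unit_normcX.
by rewrite NegzE -exprnN Normc.normcV unit_normcX// invr1.
Qed.

Lemma conjc_mul (z w : R[i]) : conjc (z * w) = conjc z * conjc w.
Proof. exact: rmorphM. Qed.

Lemma conjc_unitXz (z : R[i]) (j : int) : nc z = 1 -> conjc (z ^ j) = z ^ (- j).
Proof.
move=> z1; have w1 := unit_normcXz j z1.
apply: (mulfI (unit_neq0 w1)); rewrite mul_conjc w1 expr1n.
by rewrite -expfzDr ?unit_neq0// subrr.
Qed.

(** Induction on the degree. The correlation of shifts [h] and [h'] has the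
    automatic weight [a (n + h) * a (n + h')] and the exponent [p.[n + h] -
    p.[n + h']], of degree one less. In degree one the sum is the one of
    [kernel_family_negligible] taken at [z ^ p`_1]. *)
Lemma polynomial_negligible (k : nat) (a : nat -> R) (p : {poly int}) :
  (1 < k)%N -> kernel_automatic k a -> (1 < size p)%N ->
  negligible (fun N z => N%:R^-1 * \sum_(n < N) (a n)%:C * z ^ p.[n%:Z]).
Proof.
move=> k1; case sp : (size p) => [//|[//|m]] ka _.
elim: m p sp a ka => [|m IH] p sp a ka.
  have pn n : p.[n%:Z] = p`_0 + p`_1 * n%:Z.
    rewrite horner_coef sp big_ord_recr big_ord1 /=; ring.
  have p1 : p`_1 != 0.
    by have := lead_coef_eq0 p; rewrite lead_coefE sp /= -size_poly_eq0 sp => ->.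
  have [S [step [C [F [s [Fk aF]]]]]] := ka.
  have nF := kernel_family_negligible s k1 Fk.
  have {}nF : negligible (fun N z => N%:R^-1 * \sum_(n < N) (a n)%:C * (z ^ p`_1) ^+ n).
    case: p`_1 p1 => [c|c] c0.
      have c0' : (0 < c)%N by case: c c0.
      apply: negligible_le (negligible_expr c0' nF) => N z _.
      by under eq_bigr do rewrite aF.
    apply: negligible_le (negligible_inv (negligible_expr (ltn0Sn c) nF)) => N z _.
    by under eq_bigr do rewrite aF NegzE -exprnN -exprVn.
  apply: negligible_le nF => N z z1.
  under eq_bigr do rewrite pn expfzDr ?unit_neq0// -exprz_exp -exprnP mulrCA.
  by rewrite -mulr_sumr mulrCA Normc.normcM unit_normcXz// mul1r.
move=> eta eta0 e e0.
have [C C0 aC] := kernel_automatic_bounded ka.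
(* Van der Corput's inequality will bound the main term by [e / 2], hence the
   budget [(e / 2) ^+ 2 = e ^+ 2 / 8 + e ^+ 2 / 8] for the diagonal and the
   other correlations. *)
have [H HP] := ltr_bound_nat (C ^+ 2 / (e ^+ 2 / 8)).
have e8 : 0 < e ^+ 2 / 8 by rewrite divr_gt0 ?exprn_gt0.
have H0 : 0 < H%:R :> R by apply: le_lt_trans HP; rewrite divr_ge0 ?sqr_ge0// ltW.
pose q (h h' : nat) := (p \Po ('X + (h%:Z)%:P)) - (p \Po ('X + (h'%:Z)%:P)).
pose corr (hh : 'I_H * 'I_H) N (z : R[i]) : R[i] := N%:R^-1 * \sum_(n < N)
  (a (n + hh.1)%N * a (n + hh.2)%N)%:C * z ^ (q hh.1 hh.2).[n%:Z].
have ncorr (hh : 'I_H * 'I_H) : hh.1 != hh.2 -> negligible (corr hh).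
  move=> ne; apply: (IH (q hh.1 hh.2) _ (fun n => a (n + hh.1)%N * a (n + hh.2)%N)).
    by apply: size_translate_sub => //; exact: pchar_num.
  by apply: kernel_automaticM; exact: kernel_automatic_shift.
have [B [N0 BN]] := negligible_family ncorr eta0 e8.
have [N1 N1P] := ltr_bound_nat (2 * (H%:R * C) / (e / 2)).
exists B, (maxn 1 (maxn N0 N1)) => N z.
rewrite !geq_max => /and3P[N_gt0 NN0 NN1] z1 zB.
have N_gt0' : 0 < N%:R :> R by rewrite ltr0n.
rewrite Normc.normcM Normc.normcV normc_natr ler_pdivrMl//.
have vdc := @van_der_corput R (fun n => (a n)%:C * z ^ p.[n%:Z]) C (e ^+ 2 / 8) (e / 2) N H.
apply: (le_trans (vdc _ _ _ _ _ _)).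
- by rewrite -(ltr_nat R).
- by move=> n; rewrite Normc.normcM unit_normcXz// mulr1 normc_realE.
- exact: ltW.
- by rewrite divr_ge0// ltW.
- move=> h h' hH h'H ne.
  have := BN (Ordinal hH, Ordinal h'H) N z ne NN0 z1 zB.
  rewrite /corr Normc.normcM Normc.normcV normc_natr ler_pdivrMl//=.
  apply: le_trans; rewrite le_eqVlt; apply/orP; left; apply/eqP; congr nc.
  apply: eq_bigr => n _; cbv beta; rewrite conjc_mul conjc_unitXz//.
  have -> : conjc ((a (n + h')%N)%:C) = (a (n + h')%N)%:C by rewrite /= oppr0.
  rewrite [in RHS]rmorphM mulrACA -expfzDr ?unit_neq0//; congr (_ * z ^ _).
  by rewrite /q hornerD hornerN !horner_comp !hornerE -!PoszD.
- have : C ^+ 2 / H%:R <= e ^+ 2 / 8.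
    by rewrite ler_pdivrMr// mulrC -ler_pdivrMr// ltW.
  rewrite exprMn; lra.
have -> : N%:R * e = N%:R * (e / 2) + N%:R * (e / 2) by lra.
rewrite lerD2l; move: N1P; rewrite ltr_pdivrMr; last by lra.
by move=> /ltW/le_trans; apply; rewrite ler_wpM2r ?ler_nat//; lra.
Qed.

End PolynomialExponents.

(** * A finitary Herglotz theorem *)

Lemma prim_root_exists (F : closedFieldType) n : n%:R != 0 :> F ->
  exists w : F, n.-primitive_root w.
Proof.
move=> n0; have n_gt0 : (0 < n)%N by case: n n0; rewrite ?mulr0n ?eqxx.
have [r Dr] := closed_field_poly_normal ('X^n - 1 : {poly F}).
rewrite (monicP (monicXnsubC _ n_gt0)) scale1r in Dr.
have size_r : size r = n.
  by apply: succn_inj; rewrite -(size_prod_XsubC r id) -Dr size_XnsubC.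
suff /hasP[w _ w_prim] : has n.-primitive_root r by exists w.
apply: has_prim_root; rewrite ?size_r//.
  by apply/allP => w; rewrite -root_prod_XsubC -Dr.
by rewrite -separable_prod_XsubC -Dr separable_Xn_sub_1.
Qed.

Lemma sum_expr_root (F : fieldType) (u : F) M : u ^+ M = 1 ->
  \sum_(i < M) u ^+ i = M%:R *+ (u == 1).
Proof.
move=> uM; have [->|u1] := eqVneq u 1.
  by under eq_bigr do rewrite expr1n; rewrite sumr_const card_ord.
apply: (mulfI (x := u - 1)); first by rewrite subr_eq0.
by rewrite -subrX1 uM subrr mulr0n mulr0.
Qed.

Section Herglotz.
Context {R : realType}.
Local Notation nc := (@Normc.normc R).
Local Notation "x %:C" := (real_complex R x) (at level 1, format "x %:C").

Definition trig_poly (N : nat) (c : nat -> R) (e : nat -> int) (z : R[i]) : R[i] :=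
  \sum_(n < N) (c n)%:C * z ^ e n.

(** The mean square of [trig_poly N c e] for the measure on the circle with
    Fourier coefficients [gamma]. *)
Definition toeplitz_form (gamma : int -> R) (N : nat) (c : nat -> R)
    (e : nat -> int) : R :=
  \sum_(n < N) \sum_(m < N) c n * c m * gamma (e n - e m).

Definition positive_definite (gamma : int -> R) :=
  [/\ forall j, gamma (- j) = gamma j, forall j, `|gamma j| <= gamma 0
    & forall N c, 0 <= toeplitz_form gamma N c Posz].

Context (gamma : int -> R) (gamma_pd : positive_definite gamma).

(** The Fejer mean at [z] of the Fourier series with coefficients [gamma],
    divided by [M]: the mass to put at [z] when [z] is an [M]-th root of
    unity. *)
Definition fejer_mass (M : nat) (z : R[i]) : R :=
  (M%:R ^+ 2)^-1 * \sum_(n < M) \sum_(m < M)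
    gamma (n%:Z - m%:Z) * complex.Re (z ^+ n * conjc (z ^+ m)).

Lemma fejer_mass_ge0 M z : 0 <= fejer_mass M z.
Proof.
have [_ _ pd] := gamma_pd.
rewrite /fejer_mass mulr_ge0 ?invr_ge0 ?exprn_ge0//.
have := addr_ge0 (pd M (fun n => complex.Re (z ^+ n))) (pd M (fun n => complex.Im (z ^+ n))).
congr (0 <= _); rewrite /toeplitz_form -big_split /=; apply: eq_bigr => n _.
rewrite -big_split /=; apply: eq_bigr => m _.
by case: (z ^+ n) => a b; case: (z ^+ m) => c d /=; ring.
Qed.

Lemma fejer_massE M z : (fejer_mass M z)%:C = (M%:R ^+ 2)^-1 *
  \sum_(n < M) \sum_(m < M) (gamma (n%:Z - m%:Z))%:C * (z ^+ n * conjc (z ^+ m)).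
Proof.
have [even _ _] := gamma_pd.
rewrite /fejer_mass rmorphM fmorphV rmorphXn rmorph_nat; congr (_ * _).
set S := (X in _ = X).
have ReS : complex.Re S = \sum_(n < M) \sum_(m < M)
    gamma (n%:Z - m%:Z) * complex.Re (z ^+ n * conjc (z ^+ m)).
  rewrite /S raddf_sum; apply: eq_bigr => n _; rewrite raddf_sum; apply: eq_bigr => m _.
  by case: (_ * conjc _) => a b /=; rewrite mul0r subr0.
have SJ : conjc S = S.
  rewrite /S rmorph_sum exchange_big /=; apply: eq_bigr => n _.
  rewrite rmorph_sum /=; apply: eq_bigr => m _.
  rewrite -even opprB !rmorphM /= conjcK oppr0 mulrC.
  by rewrite [conjc _ * _]mulrC [RHS]mulrC.
have ImS : complex.Im S = 0.
  by have := congr1 (@complex.Im R) SJ; case: (S) => a b /= ?; lra.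
by rewrite -ReS; move: ImS; case: (S) => a b /= ->.
Qed.

(** Orthogonality of the characters of the cyclic group of order [M]: for each
    [n] it selects the one index [m] congruent to [n + j]. *)
Lemma fejer_mass_moment M w j : (0 < M)%N -> nc w = 1 -> M.-primitive_root w ->
  \sum_(i < M) (fejer_mass M (w ^+ i))%:C * (w ^+ i) ^+ j =
  (M%:R^-1 * \sum_(n < M) gamma (n%:Z - ((n + j) %% M)%N%:Z))%:C.
Proof.
move=> M0 w1 wprim.
have wz0 : w != 0 by exact: unit_neq0.
have M0' : M%:R != 0 :> R[i] by rewrite pnatr_eq0 -lt0n.
under eq_bigr do rewrite fejer_massE -mulrA mulr_suml.
rewrite -mulr_sumr exchange_big /= rmorphM fmorphV rmorph_nat.
rewrite expr2 invfM -!mulrA; congr (_ * _).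
rewrite rmorph_sum mulr_sumr; apply: eq_bigr => n _.
under eq_bigr do rewrite mulr_suml.
rewrite exchange_big /=.
have lt_r : ((n + j) %% M < M)%N by rewrite ltn_mod.
have orth (m : 'I_M) : \sum_(i < M) (gamma (n%:Z - m%:Z))%:C *
    ((w ^+ i) ^+ n * conjc ((w ^+ i) ^+ m)) * (w ^+ i) ^+ j =
    (gamma (n%:Z - m%:Z))%:C * (M%:R *+ (m == Ordinal lt_r)).
  under eq_bigr do rewrite -mulrA.
  rewrite -mulr_sumr; congr (_ * _).
  have -> : (m == Ordinal lt_r) = (w ^+ (n + j) / w ^+ m == 1).
    rewrite -(inj_eq (mulIf (expf_neq0 m wz0))) mulfVK ?expf_neq0// mul1r.
    by rewrite (eq_prim_root_expr wprim) -val_eqE /= eq_sym [in RHS](modn_small (ltn_ord m)).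
  rewrite -sum_expr_root; last first.
    rewrite expr_div_n -!exprM mulnC [(m * M)%N]mulnC !exprM.
    by rewrite (prim_expr_order wprim) !expr1n divr1.
  apply: eq_bigr => i _.
  have -> : conjc ((w ^+ i) ^+ m) = ((w ^+ i) ^+ m)^-1.
    by have := conjc_unitXz m (unit_normcX i w1); rewrite exprnN.
  rewrite expr_div_n exprD exprMn -!exprM [(n * i)%N]mulnC [(j * i)%N]mulnC [(m * i)%N]mulnC.
  by rewrite -!mulrA [_^-1 * _]mulrC.
under eq_bigr do rewrite orth.
rewrite (bigD1 (Ordinal lt_r)) //= eqxx big1 ?addr0 => [|m /negbTE->].
  by rewrite mulr1n mulrC mulfK.
by rewrite mulr0n mulr0.
Qed.

(** The index wraps around for at most [j] of the [M] values of [n]; all the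
    others give [gamma (- j)]. *)
Lemma cyclic_autocorrelation_le M j : (0 < M)%N ->
  `|M%:R^-1 * \sum_(n < M) gamma (n%:Z - ((n + j) %% M)%N%:Z) - gamma j%:Z| <=
  2 * j%:R * gamma 0 / M%:R.
Proof.
have [even bnd _] := gamma_pd => M0.
have M0' : 0 < M%:R :> R by rewrite ltr0n.
have g0 : 0 <= gamma 0 by apply: le_trans (bnd 0); exact: normr_ge0.
rewrite ler_pdivlMr// -[X in _ * X](ger0_norm (ltW M0')) -normrM mulrBl.
rewrite mulrAC mulVf ?gt_eqF// mul1r.
have -> : gamma j%:Z * M%:R = \sum_(n < M) gamma j%:Z.
  by rewrite sumr_const card_ord mulr_natr.
rewrite -sumrB; apply: (le_trans (ler_norm_sum _ _ _)).
apply: (@le_trans _ _ (\sum_(n < M) (2 * gamma 0) *+ (M <= n + j)%N)).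
  apply: ler_sum => n _; case: leqP => nj.
    rewrite mulr1n; apply: (le_trans (ler_normB _ _)).
    by rewrite mulr_natl mulr2n lerD.
  by rewrite mulr0n modn_small// PoszD opprD addrA subrr add0r even subrr normr0.
under eq_bigr do rewrite -mulr_natr.
rewrite -mulr_sumr [leRHS]mulrAC ler_wpM2l ?mulr_ge0// -natr_sum ler_nat.
have count k : (\sum_(n < k) (M <= n + j) <= k + j - M)%N.
  elim: k => [|k IH]; first by rewrite big_ord0.
  rewrite big_ord_recr /=; move: IH; set x := (\sum_(n < k) _)%N.
  by case: (leqP M (k + j)); lia.
by apply: leq_trans (count M) _; rewrite addKn.
Qed.

Lemma Re_unitXz z j : nc z = 1 -> complex.Re (z ^ j) = complex.Re (z ^+ `|j|%N).
Proof.
case: j => // n z1; rewrite NegzE -conjc_unitXz// abszN.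
by rewrite -exprnP; case: (z ^+ _).
Qed.

Lemma sqr_trig_polyE N c e z : nc z = 1 -> nc (trig_poly N c e z) ^+ 2 =
  \sum_(n < N) \sum_(m < N) c n * c m * complex.Re (z ^+ `|e n - e m|%N).
Proof.
move=> z1.
have : (nc (trig_poly N c e z) ^+ 2)%:C =
    \sum_(n < N) \sum_(m < N) (c n * c m)%:C * z ^ (e n - e m).
  rewrite -mul_conjc /trig_poly rmorph_sum /= mulr_suml; apply: eq_bigr => n _.
  rewrite mulr_sumr; apply: eq_bigr => m _.
  rewrite conjc_mul conjc_unitXz// mulrACA -expfzDr ?unit_neq0//.
  by rewrite [in RHS]rmorphM /= oppr0.
move=> /(congr1 (@complex.Re R)) /= ->.
rewrite raddf_sum; apply: eq_bigr => n _; rewrite raddf_sum; apply: eq_bigr => m _.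
rewrite -Re_unitXz//; case: (z ^ _) => a b /=; ring.
Qed.

Lemma fejer_mass_form_le M w N c e : (0 < M)%N -> nc w = 1 -> M.-primitive_root w ->
  `|\sum_(i < M) fejer_mass M (w ^+ i) * nc (trig_poly N c e (w ^+ i)) ^+ 2 -
    toeplitz_form gamma N c e| <=
  (\sum_(n < N) \sum_(m < N) `|c n * c m| * (2 * `|e n - e m|%N%:R * gamma 0)) / M%:R.
Proof.
move=> M0 w1 wprim; have [even _ _] := gamma_pd.
have -> : \sum_(i < M) fejer_mass M (w ^+ i) * nc (trig_poly N c e (w ^+ i)) ^+ 2 =
    \sum_(n < N) \sum_(m < N) c n * c m *
    (M%:R^-1 * \sum_(r < M) gamma (r%:Z - ((r + `|e n - e m|) %% M)%N%:Z)).
  under eq_bigr do rewrite sqr_trig_polyE ?unit_normcX// mulr_sumr.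
  rewrite exchange_big; apply: eq_bigr => n _.
  under eq_bigr do rewrite mulr_sumr.
  rewrite exchange_big; apply: eq_bigr => m _ /=.
  under eq_bigr do rewrite mulrCA.
  rewrite -mulr_sumr; congr (_ * _).
  have := fejer_mass_moment `|e n - e m|%N M0 w1 wprim.
  move=> /(congr1 (@complex.Re R)) /= <-.
  rewrite raddf_sum; apply: eq_bigr => i _.
  by case: ((w ^+ i) ^+ _) => a b /=; rewrite mul0r subr0.
rewrite /toeplitz_form -sumrB mulr_suml.
apply: (le_trans (ler_norm_sum _ _ _)); apply: ler_sum => n _.
rewrite -sumrB mulr_suml.
apply: (le_trans (ler_norm_sum _ _ _)); apply: ler_sum => m _.
rewrite -mulrBr normrM -mulrA ler_wpM2l//.
have -> : gamma (e n - e m) = gamma `|e n - e m|%N%:Z.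
  by case: (e n - e m) => k //; rewrite NegzE even abszN.
exact: cyclic_autocorrelation_le.
Qed.

(** Herglotz's theorem without the passage to a limit measure, which would
    need compactness: finitely supported positive measures on the circle whose
    Fourier coefficients converge to [gamma]. *)
Lemma toeplitz_form_spectral : exists (mass : nat -> nat -> R) (pt : nat -> nat -> R[i]),
  [/\ forall m i, 0 <= mass m i, forall m i, nc (pt m i) = 1 & forall N c e,
    (fun m => \sum_(i < m.+1) mass m i * nc (trig_poly N c e (pt m i)) ^+ 2)%R
      @ \oo --> toeplitz_form gamma N c e]%classic.
Proof.
have /choice[w wP] : forall m, exists w : R[i], m.+1.-primitive_root w.
  by move=> m; apply: prim_root_exists; rewrite pnatr_eq0.
have w1 m : nc (w m) = 1.
  have := congr1 nc (prim_expr_order (wP m)).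
  rewrite normcX Normc.normc1 => /eqP; rewrite pexpr_eq1// ?normc_ge0//.
  by move=> /eqP.
exists (fun m i => fejer_mass m.+1 (w m ^+ i)), (fun m i => w m ^+ i).
split=> [m i|m i|N c e]; [exact: fejer_mass_ge0|exact: unit_normcX|].
apply/cvgrPdist_le => eps eps0.
set K := \sum_(n < N) \sum_(m < N) `|c n * c m| * (2 * `|e n - e m|%N%:R * gamma 0).
have [M0 M0P] := ltr_bound_nat (K / eps).
exists M0 => // m /= Mm; rewrite distrC.
apply: (le_trans (fejer_mass_form_le _ _ _ (ltn0Sn m) (w1 m) (wP m))).
rewrite -/K ler_pdivrMr// mulrC -ler_pdivrMr// (le_trans (ltW M0P))// ler_nat.
exact: leqW.
Qed.

End Herglotz.

(** * From exponential sums to quadratic forms *)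

Section WeightedForms.
Context {R : realType} (gamma : int -> R) (gamma_pd : positive_definite gamma).
Local Notation nc := (@Normc.normc R).
Local Notation "x %:C" := (real_complex R x) (at level 1, format "x %:C").
Local Notation form := (toeplitz_form gamma).

Lemma toeplitz_form_ge0 N c e : 0 <= form N c e.
Proof.
have [mass [pt [mass0 _ spec]]] := toeplitz_form_spectral gamma_pd.
apply: (cvgr_to_ge (spec N c e)); near=> m.
by apply: sumr_ge0 => i _; rewrite mulr_ge0// sqr_ge0.
Unshelve. all: by end_near. Qed.

(** Integrate the pointwise inequality against the approximating measures and
    let [m] tend to infinity. *)
Lemma toeplitz_form_le (N : nat) (c : nat -> R) (e : nat -> int) (d A : R) (B : nat)
    (N' : nat -> nat) (c' : nat -> nat -> R) (e' : nat -> nat -> int) :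
  (forall z, nc z = 1 -> nc (trig_poly N c e z) ^+ 2 <=
     d ^+ 2 + A * \sum_(q < B) nc (trig_poly (N' q) (c' q) (e' q) z) ^+ 2) ->
  form N c e <= d ^+ 2 * gamma 0 + A * \sum_(q < B) form (N' q) (c' q) (e' q).
Proof.
move=> le_pt.
have [mass [pt [mass0 pt1 spec]]] := toeplitz_form_spectral gamma_pd.
have -> : d ^+ 2 * gamma 0 = form 1 (fun=> d) (fun=> 0).
  by rewrite /toeplitz_form !big_ord1 subrr -expr2.
have sumcvg : ((fun m => \sum_(q < B) \sum_(i < m.+1)
      mass m i * nc (trig_poly (N' q) (c' q) (e' q) (pt m i)) ^+ 2)%R
    @ \oo --> \sum_(q < B) form (N' q) (c' q) (e' q))%classic.
  elim: B {le_pt} => [|B IH].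
    by under eq_fun do rewrite big_ord0; rewrite big_ord0; exact: cvg_cst.
  under eq_fun do rewrite big_ord_recr /=; rewrite big_ord_recr /=.
  by apply: cvgD => //; exact: spec.
have rhscvg := cvgD (spec 1%N (fun=> d) (fun=> 0)) (cvgMl_tmp (a := A) sumcvg).
refine (ler_cvg_to (spec N c e) (rhscvg _ _) _).
near=> m; rewrite !fctE exchange_big /= mulr_sumr -big_split /=.
apply: ler_sum => i _; rewrite -mulr_sumr [A * _]mulrCA -mulrDr ler_wpM2l//.
have -> : nc (trig_poly 1 (fun=> d) (fun=> 0) (pt m i)) ^+ 2 = d ^+ 2.
  by rewrite /trig_poly big_ord1 expr0z mulr1 normc_realE real_normK ?num_real.
exact: le_pt.
Unshelve. all: by end_near. Qed.

Lemma sum_geometric_le1 (B : nat) : \sum_(q < B) (2 ^+ q.+1)^-1 <= 1 :> R.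
Proof.
suff -> : \sum_(q < B) (2 ^+ q.+1)^-1 = 1 - (2 ^+ B)^-1 :> R.
  by rewrite lerBlDr lerDl invr_ge0 exprn_ge0.
elim: B => [|B IH]; first by rewrite big_ord0 expr0 invr1 subrr.
by rewrite big_ord_recr /= IH exprS invfM; lra.
Qed.

Definition mean_trig_poly (q M : nat) : R[i] -> R[i] :=
  trig_poly M (fun=> M%:R^-1) (fun n => (q * n)%N%:Z).

(** Near a [q]-th root of unity all [M] terms are close to [1]. *)
Lemma mean_trig_poly_ge (q M : nat) z : (0 < M)%N -> nc z = 1 ->
  nc (z ^+ q - 1) < (2 * M%:R)^-1 -> 2^-1 <= nc (mean_trig_poly q M z).
Proof.
move=> M0 z1 small; have M0' : 0 < M%:R :> R by rewrite ltr0n.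
have dev : nc (mean_trig_poly q M z - 1) <= 2^-1.
  have -> : mean_trig_poly q M z - 1 = (M%:R^-1)%:C * \sum_(n < M) ((z ^+ q) ^+ n - 1).
    rewrite sumrB sumr_const card_ord mulrBr fmorphV rmorph_nat mulVf; last first.
      by rewrite pnatr_eq0 -lt0n.
    rewrite /mean_trig_poly /trig_poly mulr_sumr; congr (_ - _); apply: eq_bigr => n _.
    by rewrite fmorphV rmorph_nat -exprM.
  rewrite Normc.normcM normc_realE normrV ?unitfE ?gt_eqF// normr_nat ler_pdivrMl//.
  apply: (@normc_sumW _ _ (fun n => (z ^+ q) ^+ n - 1)) => n nM.
  apply: le_trans (normc_subX_le n (unit_normcX q z1)) _.
  apply: (@le_trans _ _ (M%:R * nc (z ^+ q - 1))).
    by rewrite ler_wpM2r ?normc_ge0// ler_nat ltnW.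
  by rewrite -ler_pdivlMl// -invfM mulrC ltW// mulrC.
have := le_normcD (mean_trig_poly q M z) (1 - mean_trig_poly q M z).
by rewrite addrC subrK Normc.normc1 normcB_sym; lra.
Qed.

(** For [q = 1, 2, ...] choose the length [M q] so that the form of
    [mean_trig_poly q (M q)] is at most [e' * 2 ^- q], and the radius
    [1/(2 * M q)] accordingly. Off the minor arc, one of these polynomials has
    modulus at least [1/2] and so dominates the weighted average, which is
    bounded by [C]; the total of their forms is at most [e']. *)
Theorem weighted_form_cvg0 (k : nat) (a : nat -> R) (p : {poly int}) :
  (1 < k)%N -> kernel_automatic k a -> (1 < size p)%N ->
  (forall q, (0 < q)%N ->
     ((fun M => form M (fun=> M%:R^-1) (fun n => (q * n)%N%:Z)) @ \oo --> (0 : R))%classic) ->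
  ((fun N => form N (fun n => N%:R^-1 * a n) (fun n => p.[n%:Z])) @ \oo --> (0 : R))%classic.
Proof.
move=> k1 ka sp erg; apply/cvgrPdist_le => eps eps0.
have [_ bnd _] := gamma_pd.
have g0 : 0 <= gamma 0 by apply: le_trans (bnd 0); exact: normr_ge0.
have [C C0 aC] := kernel_automatic_bounded ka.
(* As [d <= 1], this makes [d ^+ 2 * gamma 0] at most [eps / 2]. *)
pose d := eps / (eps + 2 * (gamma 0 + 1)).
have den0 : 0 < eps + 2 * (gamma 0 + 1) by lra.
have d0 : 0 < d by rewrite divr_gt0.
have dg : d ^+ 2 * gamma 0 <= eps / 2.
  have d1 : d <= 1 by rewrite ler_pdivrMr// mul1r; lra.
  have : d * (eps + 2 * (gamma 0 + 1)) = eps by rewrite mulfVK ?gt_eqF.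
  by nra.
pose e' := eps / (8 * (C ^+ 2 + 1)).
have C2 : 0 <= C ^+ 2 by exact: sqr_ge0.
have e'0 : 0 < e' by rewrite divr_gt0// mulr_gt0//; lra.
have /choice[M MP] : forall q, exists M, (0 < M)%N /\ ((0 < q)%N ->
    form M (fun=> M%:R^-1) (fun n => (q * n)%N%:Z) <= e' * (2 ^+ q)^-1).
  move=> q; have [->|q0] := posnP q; first by exists 1%N.
  have r0 : 0 < e' * (2 ^+ q)^-1 by rewrite mulr_gt0// invr_gt0 exprn_gt0.
  have /cvgrPdist_le /(_ _ r0) [M _ MP] := erg q q0.
  exists M.+1; split=> // _; have := MP M.+1 (leqnSn M).
  by rewrite sub0r normrN; apply: le_trans; exact: ler_norm.
have M0 q : 0 < (2 * (M q)%:R)^-1 :> R.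
  by rewrite invr_gt0 mulr_gt0// ltr0n; case: (MP q).
have [B [N0 BN]] := polynomial_negligible k1 ka sp M0 d0.
exists (maxn 1 N0) => // N /=; rewrite geq_max => /andP[N_gt0 NN0].
have N_gt0' : 0 < N%:R :> R by rewrite ltr0n.
rewrite sub0r normrN ger0_norm ?toeplitz_form_ge0//.
have polyE z : trig_poly N (fun n => N%:R^-1 * a n) (fun n => p.[n%:Z]) z =
    N%:R^-1 * \sum_(n < N) (a n)%:C * z ^ p.[n%:Z].
  rewrite mulr_sumr; apply: eq_bigr => n _.
  by rewrite rmorphM fmorphV rmorph_nat mulrA.
apply: (le_trans (@toeplitz_form_le N _ _ d (4 * C ^+ 2) B (fun q => M q.+1)
  (fun q _ => (M q.+1)%:R^-1) (fun q n => (q.+1 * n)%N%:Z) _)).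
  move=> z z1.
  have G0 (q : 'I_B) : 0 <= nc (mean_trig_poly q.+1 (M q.+1) z) ^+ 2 by exact: sqr_ge0.
  have [good|bad] := pselect (minor_arc (fun q => (2 * (M q)%:R)^-1) B z).
    rewrite -[leLHS]addr0 lerD//; last first.
      apply: mulr_ge0; first by apply: mulr_ge0.
      by apply: sumr_ge0 => q _; exact: sqr_ge0.
    by rewrite ler_sqr ?nnegrE ?normc_ge0 ?(ltW d0)// polyE BN.
  have [q [q0B small]] : exists q, (0 < q <= B)%N /\
      nc (z ^+ q - 1) < (2 * (M q)%:R)^-1.
    apply: contrapT => h; apply: bad => q q0B; rewrite leNgt; apply/negP => small.
    by apply: h; exists q.
  case: q q0B small => [//|q] /= qB small.
  have Gge := mean_trig_poly_ge (proj1 (MP q.+1)) z1 small.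
  rewrite (bigD1 (Ordinal qB)) //= mulrDr addrCA -[leLHS]addr0 lerD//; last first.
    apply: addr_ge0; first exact: sqr_ge0.
    apply: mulr_ge0; first by apply: mulr_ge0.
    by apply: sumr_ge0 => i _; exact: sqr_ge0.
  have -> : 4 * C ^+ 2 * nc (mean_trig_poly q.+1 (M q.+1) z) ^+ 2 =
     (2 * C * nc (mean_trig_poly q.+1 (M q.+1) z)) ^+ 2 by ring.
  rewrite ler_sqr ?nnegrE ?normc_ge0 ?mulr_ge0 ?(ltW C0)//; last exact: normc_ge0.
  apply: (@le_trans _ _ C); last first.
    by move: Gge; set g := nc _; nra.
  rewrite polyE Normc.normcM Normc.normcV normc_natr ler_pdivrMl//.
  apply: (@normc_sumW _ _ (fun n => (a n)%:C * z ^ p.[n%:Z])) => n _.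
  by rewrite Normc.normcM unit_normcXz// mulr1 normc_realE.
have -> : eps = eps / 2 + eps / 2 by lra.
apply: lerD => //.
apply: (@le_trans _ _ (4 * C ^+ 2 * \sum_(q < B) e' * (2 ^+ q.+1)^-1)).
  apply: ler_wpM2l; first by apply: mulr_ge0.
  apply: ler_sum => q _.
  by have [_ h] := MP q.+1; exact: h.
rewrite -mulr_sumr.
apply: (@le_trans _ _ (4 * C ^+ 2 * e')).
  apply: ler_wpM2l; first by apply: mulr_ge0.
  rewrite -[leRHS]mulr1 ler_wpM2l ?(ltW e'0)//.
  exact: sum_geometric_le1.
have : e' * (8 * (C ^+ 2 + 1)) = eps by rewrite mulfVK// gt_eqF// mulr_gt0//; lra.
by nra.
Qed.

End WeightedForms.

(** * Measure-preserving maps and the maximal ergodic theorem *)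

Section MeasurePreserving.
Local Open Scope classical_set_scope.
Context {R : realType} {d : measure_display} {X : measurableType d}.
Context (mu : probability X R).
Implicit Types (f g h : X -> R) (T : X -> X).

Local Notation L1 g := (mu.-integrable [set: X] (EFin \o g)).
Local Notation E g := (\int[mu]_x g x)%R.

Lemma measure_preserving_iter T n :
  measure_preserving mu T -> measure_preserving mu (iter n T).
Proof.
move=> [mT pT]; elim: n => [|n [mI pI]]; first by split; [exact: measurable_id|].
split; first exact: (measurableT_comp mT mI).
move=> A mA; rewrite -[RHS]pT// -[RHS]pI//.
by rewrite -[X in measurable X]setTI; exact: mT.
Qed.

Lemma measurable_L1 g : L1 g -> measurable_fun [set: X] g.
Proof. by move=> /integrableP[/measurable_EFinP]. Qed.

Lemma ge0_integral_mp T (f : X -> \bar R) : measure_preserving mu T ->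
  measurable_fun [set: X] f -> (forall x, 0 <= f x)%E ->
  (\int[mu]_x f (T x) = \int[mu]_x f x)%E.
Proof.
move=> [mT pT] mf f0.
have /= := @ge0_integral_pushforward _ _ X X R T mT mu setT f measurableT mf (fun x _ => f0 x).
rewrite preimage_setT => <-.
by apply: eq_measure_integral => A mA _; exact: pT.
Qed.

Lemma L1_mp T g : measure_preserving mu T -> L1 g -> L1 (g \o T).
Proof.
move=> mpT Lg; have mg := measurable_L1 Lg; move/integrableP : Lg => [_ fin].
apply/integrableP; split.
  by apply/measurable_EFinP; apply: measurableT_comp => //; case: mpT.
rewrite (ge0_integral_mp mpT (f := fun x => `|(g x)%:E|%E))//.
by apply/measurable_EFinP; exact: measurableT_comp.
Qed.

Lemma Rintegral_mp T g : measure_preserving mu T -> L1 g -> E (g \o T) = E g.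
Proof.
move=> mpT Lg; have mg := measurable_L1 Lg; have [mT pT] := mpT.
have LgT := L1_mp mpT Lg.
have /= eq := @integral_pushforward _ _ X X R T mT mu setT (EFin \o g) _ _ measurableT.
rewrite /Rintegral; congr fine.
rewrite preimage_setT in eq; rewrite -eq//; last exact/measurable_EFinP.
by apply: eq_measure_integral => A mA _; exact: pT.
Qed.

Lemma L1_cst (r : R) : L1 (cst r).
Proof. by apply: finite_measure_integrable_cst. Qed.

Lemma L1D f g : L1 f -> L1 g -> L1 (fun x => f x + g x).
Proof. by move=> Lf Lg; exact: (integrableD measurableT Lf Lg). Qed.

Lemma L1Z (r : R) g : L1 g -> L1 (fun x => r * g x).
Proof. by move=> Lg; exact: (integrableZl measurableT r Lg). Qed.

Lemma L1N g : L1 g -> L1 (fun x => - g x).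
Proof. by move=> Lg; exact: (integrableN Lg). Qed.

Lemma L1_sum n (F : nat -> X -> R) : (forall i, L1 (F i)) ->
  L1 (fun x => \sum_(i < n) F i x).
Proof.
move=> LF; elim: n => [|n IH].
  by under eq_fun do rewrite big_ord0; exact: L1_cst.
by under eq_fun do rewrite big_ord_recr; exact: L1D.
Qed.

Lemma Rintegral_sum n (F : nat -> X -> R) : (forall i, L1 (F i)) ->
  E (fun x => \sum_(i < n) F i x) = \sum_(i < n) E (F i).
Proof.
move=> LF; elim: n => [|n IH].
  rewrite big_ord0; under eq_Rintegral do rewrite big_ord0.
  by rewrite Rintegral_cst// mul0r.
rewrite big_ord_recr /= -IH -RintegralD//; last exact: L1_sum.
by apply: eq_Rintegral => x _; rewrite big_ord_recr.
Qed.

Lemma L1_le f g : measurable_fun [set: X] f -> L1 g ->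
  (forall x, `|f x| <= g x) -> L1 f.
Proof.
move=> mf Lg fg; apply: (le_integrable measurableT _ _ Lg).
  exact/measurable_EFinP.
by move=> x _ /=; rewrite lee_fin (le_trans (fg x)) ?ler_norm.
Qed.

End MeasurePreserving.

Section Maximal.
Local Open Scope classical_set_scope.
Context {R : realType} {d : measure_display} {X : measurableType d}.
Context (mu : probability X R) (T : X -> X).
Context (T_mp : measure_preserving mu T).
Implicit Types (g u : X -> R).

Local Notation L1 g := (mu.-integrable [set: X] (EFin \o g)).
Local Notation E g := (\int[mu]_x g x)%R.

Definition ergodic_sum g n x : R := \sum_(i < n) g (iter i T x).

(** The maximum of the sums [ergodic_sum g i x] over [i <= n], in a recursive
    form suited to translation by [T]. *)
Fixpoint maximal_sum g n x : R :=
  if n is n'.+1 then Num.max 0 (g x + maximal_sum g n' (T x)) else 0.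

Lemma maximal_sum_ge0 g n x : 0 <= maximal_sum g n x.
Proof. by case: n => //= n; rewrite le_max lexx. Qed.

Lemma maximal_sum_nondecreasing g n x : maximal_sum g n x <= maximal_sum g n.+1 x.
Proof.
elim: n x => [|n IH] x; first exact: maximal_sum_ge0.
by rewrite /= le_max2// lerD2l; exact: IH.
Qed.

Lemma maximal_sum_le g n m x : (n <= m)%N -> maximal_sum g n x <= maximal_sum g m x.
Proof.
move=> nm; rewrite -(subnK nm); elim: (m - n)%N => [//|k IH].
by rewrite addSn (le_trans IH)// maximal_sum_nondecreasing.
Qed.

Lemma ergodic_sum_le_maximal g n x : ergodic_sum g n x <= maximal_sum g n x.
Proof.
elim: n x => [|n IH] x; first by rewrite /ergodic_sum big_ord0.
rewrite /ergodic_sum big_ord_recl /= le_max; apply/orP; right; rewrite lerD2l.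
apply: le_trans (IH (T x)); rewrite le_eqVlt; apply/orP; left; apply/eqP.
by apply: eq_bigr => i _; rewrite -iterS -iterSr.
Qed.

Lemma L1_maximal_sum g n : L1 g -> L1 (maximal_sum g n).
Proof.
move=> Lg; have mg := measurable_L1 Lg.
elim: n => [|n IH] /=; first exact: L1_cst.
have LT := L1_mp T_mp IH.
apply: (@L1_le _ _ _ mu _ (fun x => `|g x| + maximal_sum g n (T x))).
- apply: measurable_maxr; first exact: measurable_cst.
  by apply: measurable_funD => //; exact: measurable_L1 LT.
- by apply: L1D => //; exact: (integrable_norm Lg).
- move=> x; have m0 := maximal_sum_ge0 g n (T x).
  have gle := ler_norm (g x); have g0 := normr_ge0 (g x).
  rewrite ger0_norm ?le_max ?lexx// ge_max; apply/andP; split; lra.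
Qed.

(** Strictly invariant under [T], so that ergodicity applies with no
    modification on a null set. *)
Definition unbounded_sums g : set X :=
  [set x | forall B : nat, exists n, B%:R < maximal_sum g n x].

Lemma measurable_unbounded_sums g : L1 g -> measurable (unbounded_sums g).
Proof.
move=> Lg.
have -> : unbounded_sums g =
    \bigcap_(B : nat) \bigcup_(n : nat) (maximal_sum g n @^-1` `]B%:R, +oo[).
  apply/seteqP; split=> [x h B _|x h B].
    by have [n hn] := h B; exists n => //=; rewrite in_itv/= hn.
  by have [n _] := h B I; rewrite /= in_itv/= andbT => hn; exists n.
apply: bigcapT_measurable => B; apply: bigcupT_measurable => n.
rewrite -[X in measurable X]setTI.
by apply: (measurable_L1 (L1_maximal_sum n Lg)); [exact: measurableT|exact: measurable_itv].
Qed.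

Lemma unbounded_sums_invariant g : T @^-1` unbounded_sums g = unbounded_sums g.
Proof.
apply/seteqP; split=> x h B.
  have [B' B'P] := ltr_bound_nat (B%:R - g x).
  have [n hn] := h B'; exists n.+1; rewrite /= lt_max; apply/orP; right; lra.
have [B' B'P] := ltr_bound_nat (B%:R + g x).
have [n] := h B'; case: n => [|n] /=.
  by rewrite ltNge ler0n.
rewrite lt_max => /orP[|hn]; first by rewrite ltNge ler0n.
by exists n; lra.
Qed.

Lemma measurable_maximal_sum_gt0 g n : L1 g ->
  measurable [set x | 0 < maximal_sum g n x].
Proof.
move=> Lg; rewrite (_ : [set _ | _] = maximal_sum g n @^-1` `]0, +oo[).
  rewrite -[X in measurable X]setTI; apply: (measurable_L1 (L1_maximal_sum n Lg)) => //.
by apply/seteqP; split=> x /=; rewrite in_itv/= andbT.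
Qed.

(** Garsia's argument: where the maximum [m] is positive it is at most
    [g + m \o T], elsewhere it vanishes and [m \o T] is nonnegative;
    integrate, using that [m] and [m \o T] have the same integral. *)
Lemma maximal_ergodic g n : L1 g ->
  0 <= E (fun x => g x * \1_[set x | 0 < maximal_sum g n x] x).
Proof.
move=> Lg; have Lm := L1_maximal_sum n Lg; have LmT := L1_mp T_mp Lm.
have mpos := measurable_maximal_sum_gt0 n Lg.
have Lgi : L1 (fun x => g x * \1_[set x | 0 < maximal_sum g n x] x).
  apply: (@L1_le _ _ _ mu _ (fun x => `|g x|)).
  - by apply: measurable_funM; [exact: measurable_L1 Lg|exact: measurable_indic].
  - exact: (integrable_norm Lg).
  - by move=> x; rewrite normrM indicE; case: (_ \in _); rewrite ?normr1 ?mulr1// normr0 mulr0.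
have : E (maximal_sum g n) <= E (fun x => g x * \1_[set x | 0 < maximal_sum g n x] x +
    (maximal_sum g n \o T) x).
  apply: le_Rintegral => //; first exact: L1D.
  move=> x _; rewrite indicE; have mT0 := maximal_sum_ge0 g n (T x).
  have [le0|pos] := leP (maximal_sum g n x) 0.
    rewrite memNset /=; last by apply/negP; rewrite -leNgt.
    by rewrite mulr0 add0r (le_trans le0).
  rewrite mem_set//= mulr1.
  case: n pos {Lm LmT mpos Lgi} mT0 => [|n]; first by rewrite /= ltxx.
  move=> pos _; rewrite -/(maximal_sum g n.+1).
  move: pos; rewrite /= lt_max ltxx /= => pos.
  rewrite (max_idPr (ltW pos)) lerD2l; exact: maximal_sum_nondecreasing.
by rewrite RintegralD// Rintegral_mp// lerDr.
Qed.

End Maximal.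

(** * The mean ergodic theorem *)

Section MeanErgodic.
Local Open Scope classical_set_scope.
Context {R : realType} {d : measure_display} {X : measurableType d}.
Context (mu : probability X R) (T : X -> X).
Context (T_mp : measure_preserving mu T) (T_erg : ergodic mu T).
Implicit Types (g u : X -> R).

Local Notation L1 g := (mu.-integrable [set: X] (EFin \o g)).
Local Notation E g := (\int[mu]_x g x)%R.
Local Notation S := (ergodic_sum T).

(** Were this set of full measure, the indicators in the maximal inequality
    would tend to [1] and the integral of [g] would be nonnegative. *)
Lemma unbounded_sums_null g : L1 g -> E g < 0 -> mu (unbounded_sums T g) = 0%E.
Proof.
move=> Lg neg; have mA := measurable_unbounded_sums T_mp Lg.
have [//|A1] := T_erg mA (unbounded_sums_invariant T g).
have mg := measurable_L1 Lg.
pose P n := [set x | 0 < maximal_sum T g n x].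
have mP n : measurable (P n) by exact: (measurable_maximal_sum_gt0 T_mp n Lg).
have bnd n x : `|g x * \1_(P n) x| <= `|g x|.
  by rewrite normrM indicE; case: (_ \in _); rewrite ?normr1 ?mulr1// normr0 mulr0.
have mf n : measurable_fun [set: X] (fun x => g x * \1_(P n) x).
  by apply: measurable_funM; [exact: measurable_L1 Lg|exact: measurable_indic].
have [] := @dominated_convergence _ _ _ mu setT measurableT
  (fun n x => (g x * \1_(P n) x)%:E) (EFin \o g) (fun x => `|g x|%:E).
- by move=> n; exact/measurable_EFinP.
- exact/measurable_EFinP.
- exists (~` unbounded_sums T g); split; first exact: measurableC.
    by have := probability_setC mu mA; rewrite A1 subee.
  move=> x; apply: contra_not => Ax _.
  have [n0] := Ax 0%N => n0P.
  apply: cvg_near_cst; exists n0 => // n /= n0n.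
  have Pnx : P n x by apply: lt_le_trans n0P _; exact: maximal_sum_le.
  by rewrite indicE mem_set//= mulr1.
- exact: (integrable_norm Lg).
- by apply: aeW => x n _; rewrite lee_fin.
move=> _ _ lim.
suff : (0 <= \int[mu]_x (g x)%:E)%E.
  by move=> pos; move: neg; rewrite /Rintegral ltNge fine_ge0.
have /= <- := cvg_lim (@ereal_hausdorff R) lim.
apply: lime_ge; first by apply/cvg_ex; eexists; exact: lim.
near=> n; have Lf : L1 (fun x => g x * \1_(P n) x).
  exact: (@L1_le _ _ _ mu _ (fun x => `|g x|) (mf n) (integrable_norm Lg) (bnd n)).
rewrite -[X in (0 <= X)%E]fineK; last exact: integrable_fin_num.
by rewrite lee_fin; exact: (maximal_ergodic T_mp n Lg).
Unshelve. all: by end_near. Qed.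

(** Centred at slightly more than its mean, [u] has negative integral, and its
    ergodic sums are bounded above almost everywhere. *)
Lemma ergodic_sum_upper u e : L1 u -> 0 < e ->
  {ae mu, forall x, exists B : R, forall n, S u n x <= n%:R * (E u + e) + B}.
Proof.
move=> Lu e0; pose g x := u x + - (E u + e).
have Lg : L1 g by apply: L1D => //; exact: L1_cst.
exists (unbounded_sums T g); split.
  - exact: (measurable_unbounded_sums T_mp Lg).
  - apply: unbounded_sums_null => //.
    rewrite RintegralD//; last exact: L1_cst.
    rewrite Rintegral_cst// (_ : fine _ = 1) ?mulr1; first lra.
    exact: (congr1 fine (probability_setT mu)).
move=> x /= h B; apply: contrapT => nB; apply: h; exists B%:R => n.
have := ergodic_sum_le_maximal T g n x.
have -> : S g n x = S u n x - n%:R * (E u + e).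
  by rewrite /ergodic_sum big_split /= sumr_const card_ord mulNrn mulr_natl.
have : maximal_sum T g n x <= B%:R.
  by rewrite leNgt; apply/negP => lt; apply: nB; exists n.
lra.
Qed.

(** The one-sided bound for [u] and for [- u], along a sequence of margins
    tending to [0]. *)
Lemma birkhoff u : L1 u ->
  {ae mu, forall x, (fun n => n%:R^-1 * S u n x) @ \oo --> E u}.
Proof.
move=> Lu; pose e (j : nat) : R := j.+1%:R^-1.
have e0 j : 0 < e j by rewrite invr_gt0 ltr0n.
have LN := L1N Lu.
have EN : E (fun x => - u x) = - E u.
  have := RintegralZl (-1) measurableT Lu; rewrite mulN1r => <-.
  by apply: eq_Rintegral => x _; rewrite mulN1r.
have /ae_foralln up : forall j, {ae mu, forall x, exists B : R, forall n,
  S u n x <= n%:R * (E u + e j) + B} by move=> j; exact: ergodic_sum_upper.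
have /ae_foralln down : forall j, {ae mu, forall x, exists B : R, forall n,
    S (fun x => - u x) n x <= n%:R * (- E u + e j) + B}.
  by move=> j; rewrite -EN; exact: ergodic_sum_upper.
apply: filterS2 up down => x up down.
apply/cvgrPdist_le => eps eps0.
have [j jP] := ltr_bound_nat (2 / eps).
have ej : e j <= eps / 2.
  rewrite /e -[leRHS]invrK lef_pV2 ?posrE ?invr_gt0 ?divr_gt0 ?ltr0n//.
  by rewrite invf_div (le_trans (ltW jP))// ler_nat.
have [B BP] := up j; have [B' B'P] := down j.
have [N NP] := ltr_bound_nat (Num.max B B' / (eps / 2)).
exists N.+1 => // n /= Nn.
have n0 : 0 < n%:R :> R by rewrite ltr0n (leq_trans _ Nn).
have : Num.max B B' <= n%:R * (eps / 2).
  rewrite -ler_pdivrMr ?divr_gt0// (le_trans (ltW NP))// ler_nat ltnW//.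
rewrite ge_max => /andP[nB nB'].
have SN : S (fun x => - u x) n x = - S u n x by rewrite /ergodic_sum sumrN.
have := BP n; have := B'P n; rewrite SN => lo hi.
rewrite distrC -[X in `|_ - X|](mulKf (lt0r_neq0 n0)) -mulrBr normrM.
rewrite gtr0_norm ?invr_gt0// ler_pdivrMl// ler_norml.
have := ler_wpM2l (ltW n0) ej => nej.
by apply/andP; split; lra.
Qed.

(** Fatou's lemma for the variances [A_n (u ^ 2) - (A_n u) ^ 2], where [A_n]
    is the ergodic average: they are nonnegative, tend to [E (u ^ 2)] almost
    everywhere by [birkhoff], and their integrals are [E (u ^ 2)] minus the
    quantity to be bounded. This avoids truncating [u]. *)
Lemma mean_ergodic u : L1 u -> L1 (fun x => u x ^+ 2) -> E u = 0 ->
  (fun n => E (fun x => (n%:R^-1 * S u n x) ^+ 2)) @ \oo --> (0 : R).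
Proof.
move=> Lu Lu2 Eu0; pose v x := u x ^+ 2.
have Lterm g i : L1 g -> L1 (fun x => g (iter i T x)).
  by move=> Lg; exact: (L1_mp (measure_preserving_iter i T_mp) Lg).
have LS g n : L1 g -> L1 (fun x => n%:R^-1 * S g n x).
  by move=> Lg; apply: L1Z; apply: (@L1_sum _ _ _ mu n (fun i x => g (iter i T x))) => i; exact: Lterm.
have jensen n x : (n%:R^-1 * S u n x) ^+ 2 <= n%:R^-1 * S v n x.
  case: n => [|n]; first by rewrite invr0 !mul0r expr0n.
  rewrite exprMn [_^-1 ^+ 2]expr2 -mulrA ler_wpM2l ?invr_ge0// ler_pdivrMl ?ltr0n//.
  exact: (sqr_sum_le _ (fun i => u (iter i T x))).
have LA2 n : L1 (fun x => (n%:R^-1 * S u n x) ^+ 2).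
  apply: (@L1_le _ _ _ mu _ (fun x => n%:R^-1 * S v n x)).
  - by apply: measurable_funX; exact: measurable_L1 (LS u n Lu).
  - exact: LS.
  - by move=> x; rewrite ger0_norm ?sqr_ge0.
pose f n x := n%:R^-1 * S v n x - (n%:R^-1 * S u n x) ^+ 2.
have Lf n : L1 (f n) by apply: L1D; [exact: LS|exact: L1N].
have f0 n x : 0 <= f n x by rewrite subr_ge0.
have Ef n : (0 < n)%N -> E (f n) = E v - E (fun x => (n%:R^-1 * S u n x) ^+ 2).
  move=> n0; rewrite RintegralB//; last exact: LS.
  congr (_ - _); rewrite RintegralZl//; last first.
    by apply: (@L1_sum _ _ _ mu n (fun i x => v (iter i T x))) => i; exact: Lterm.
  rewrite (@Rintegral_sum _ _ _ mu n (fun i x => v (iter i T x))); last by move=> i; exact: Lterm.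
  under eq_bigr do rewrite (Rintegral_mp (measure_preserving_iter _ T_mp) Lu2).
  by rewrite sumr_const card_ord -[X in _ * X]mulr_natl mulKf// pnatr_eq0 -lt0n.
have fcvg : {ae mu, forall x, (fun n => f n x) @ \oo --> E v}.
  apply: filterS2 (birkhoff Lu2) (birkhoff Lu) => x cv cu.
  rewrite -[E v]subr0 -[X in _ - X](expr0n _ 2) -Eu0.
  by apply: cvgB => //; rewrite expr2; under eq_fun do rewrite expr2; exact: cvgM.
have mf n : measurable_fun [set: X] (fun x => (f n x)%:E).
  by apply/measurable_EFinP; exact: measurable_L1 (Lf n).
have := @fatou _ _ _ mu setT measurableT (fun n x => (f n x)%:E) mf (fun n x _ => f0 n x).
have mlim : measurable_fun [set: X] (fun x => limn_einf (fun n => (f n x)%:E)).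
  apply: measurableT_comp => //; apply: measurable_fun_limn_esup => n.
  exact: measurableT_comp.
rewrite (@ae_eq_integral _ _ _ mu setT (cst (E v)%:E))//; last first.
  apply: filterS fcvg => x cx _.
  by apply: (cvg_limn_einf_sup _).1; apply/cvg_EFin => //; exact: nearW.
rewrite integral_cst// => lim_ge.
have {}lim_ge : ((E v)%:E <= limn_einf (fun n => \int[mu]_x (f n x)%:E))%E.
  apply: le_trans lim_ge; rewrite -[leLHS]mule1 le_eqVlt; apply/orP; left; apply/eqP.
  by congr (_ * _)%E; exact/esym/probability_setT.
apply/cvgrPdist_le => eps eps0.
have : ((E v - eps)%:E < limn_einf (fun n => \int[mu]_x (f n x)%:E))%E.
  by apply: lt_le_trans lim_ge; rewrite lte_fin; lra.
set w := fun n : nat => (\int[mu]_x (f n x)%:E)%E.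
have -> : limn_einf w = ereal_sup (range (einfs w)).
  by rewrite limn_einf_lim; apply: cvg_lim => //; exact: cvg_einfs_sup.
move=> /ereal_sup_gt[_ [N _ <-]] ltN; exists N.+1 => // n /= Nn.
rewrite sub0r normrN ger0_norm; last by apply: Rintegral_ge0 => x _; exact: sqr_ge0.
have : ((E v - eps)%:E < \int[mu]_x (f n x)%:E)%E.
  apply: (lt_le_trans ltN); apply: ereal_inf_lbound; exists n => //=.
  exact: ltnW.
rewrite -[X in (_ < X)%E]fineK; last exact: integrable_fin_num (Lf n).
rewrite lte_fin -/(Rintegral _ _ _) Ef; last exact: leq_trans Nn.
lra.
Qed.

End MeanErgodic.

(** * Kernels of automatic sequences *)

Section AutomaticKernel.
Context {R : realType}.

(** False for [m = 0] and [d = 0], where the right-hand side would have a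
    leading zero. *)
Lemma base_expansion_rcons (k : nat) (k1 : (1 < k)%N) (m : nat) (d : 'I_k) :
  (0 < m)%N -> base_expansion k1 (m * k + d) = rcons (base_expansion k1 m) d.
Proof.
move=> m0; have k0 := ltnW k1.
have -> : base_expansion k1 (m * k + d) = [seq Ordinal (ltn_pmod ((m * k + d) %/ k ^ i)%N (ltnW k1))
    | i <- rev (iota 0 (up_log k m.+1).+1)].
  rewrite /base_expansion; congr (map _ (rev (iota 0 _))).
  have mL := up_logP m.+1 k1; have Lm := @up_log_gtn k m.+1 k1 m0.
  have dk := ltn_ord d.
  have L0 : (0 < up_log k m.+1)%N by rewrite up_log_gt0 k1.
  apply: up_log_eq => //; apply/andP; split.
    move: Lm; rewrite -(prednK L0) /= expnS; set P := (k ^ _)%N; nia.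
  by rewrite expnSr; set P := (k ^ _)%N in mL *; nia.
rewrite /= rev_cons map_rcons; congr rcons; last first.
  by apply: val_inj; rewrite /= expn0 divn1 modnMDl modn_small.
rewrite /base_expansion (iotaDl 1 0) -map_rev -map_comp.
apply: eq_map => i; apply: val_inj => /=.
by rewrite add1n expnS divnMA divnMDl ?(ltnW k1)// (divn_small (ltn_ord d)) addn0.
Qed.

(** The states are those of the automaton; reading starts with the lowest
    digit, and the last digit can be peeled off by a single transition. *)
Lemma automatic_kernel (k : nat) (k1 : (1 < k)%N) (a : nat -> R[i]) (pi : R[i] -> R) :
  k_automatic k1 a -> kernel_automatic k (fun n => pi (a n)).
Proof.
move=> [M aM]; have k0 := ltnW k1.
pose F (s : state M) n := pi (output (trans_word s (base_expansion k1 n))).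
exists (state M), (fun s d => trans s (Ordinal (ltn_pmod d k0))).
exists (\sum_(s : state M) `|pi (output s)|), F, (init M); split; last first.
  by move=> n; rewrite aM.
split=> [s n|s m d m0 dk].
  by rewrite (bigD1 (trans_word s (base_expansion k1 n)))//= lerDl sumr_ge0.
rewrite /F -[in LHS](modn_small dk).
rewrite (base_expansion_rcons k1 (Ordinal (ltn_pmod d k0)) m0).
by rewrite -cats1 trans_word_cat.
Qed.

End AutomaticKernel.

(** * Real weights and real observables *)

Section RealWeightedAverages.
Local Open Scope classical_set_scope.
Context {R : realType} {d : measure_display} {X : measurableType d}.
Context (mu : probability X R) (T : X -> X).
Context (T_mp : measure_preserving mu T) (T_erg : totally_ergodic mu T).
Local Notation L1 g := (mu.-integrable [set: X] (EFin \o g)).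
Local Notation E g := (\int[mu]_x g x)%R.
Local Notation L2 g := (measurable_fun [set: X] g /\ L1 (fun x => g x ^+ 2)).

Lemma L2_mul (f g : X -> R) : L2 f -> L2 g -> L1 (fun x => f x * g x).
Proof.
move=> [mf Lf] [mg Lg].
apply: (@L1_le _ _ _ mu _ (fun x => f x ^+ 2 + g x ^+ 2)); first exact: measurable_funM.
  exact: L1D.
move=> x; rewrite ler_norml; apply/andP; split; nra.
Qed.

Lemma L2_L1 (f : X -> R) : L2 f -> L1 f.
Proof.
move=> Lf; have L2_1 : L2 (cst 1 : X -> R).
  split; first exact: measurable_cst.
  rewrite (_ : (fun x => cst 1 x ^+ 2) = cst 1); first exact: L1_cst.
  by apply/funext => x; rewrite /= expr1n.
rewrite (_ : f = fun x => f x * cst 1 x); first exact: L2_mul.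
by apply/funext => x; rewrite /= mulr1.
Qed.

Lemma L2_iter (f : X -> R) n : L2 f -> L2 (fun x => f (iter n T x)).
Proof.
move=> [mf Lf]; have mpn := measure_preserving_iter n T_mp.
split; first by apply: measurableT_comp => //; case: mpn.
exact: (L1_mp mpn Lf).
Qed.

Lemma L2_weighted_sum (f : X -> R) N (c : nat -> R) (e : nat -> nat) : L2 f ->
  L2 (fun x => \sum_(n < N) c n * f (iter (e n) T x)).
Proof.
move=> fL2; pose t n x := c n * f (iter (e n) T x).
have mt n : measurable_fun [set: X] (t n).
  by apply: measurable_funM; [exact: measurable_cst|case: (L2_iter (e n) fL2)].
have Lt n : L1 (fun x => t n x ^+ 2).
  under eq_fun do rewrite exprMn.
  by apply: L1Z; case: (L2_iter (e n) fL2).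
have msum : measurable_fun [set: X] (fun x => \sum_(n < N) t n x).
  exact: measurable_sum.
split=> //; apply: (@L1_le _ _ _ mu _ (fun x => N%:R * \sum_(n < N) t n x ^+ 2)).
- exact: measurable_funX.
- by apply: L1Z; exact: (L1_sum _ Lt).
- by move=> x; rewrite ger0_norm ?sqr_ge0//; exact: (sqr_sum_le _ (fun n => t n x)).
Qed.

Context (f : X -> R) (fL2 : L2 f).

(** The values at negative [j] are set by symmetry, as [T] need not be
    invertible. *)
Definition autocorrelation (j : int) : R := E (fun x => f (iter `|j| T x) * f x).
Local Notation gamma := autocorrelation.

Lemma autocorrelationE i j :
  E (fun x => f (iter i T x) * f (iter j T x)) = gamma (i%:Z - j%:Z).
Proof.
wlog ij : i j / (j <= i)%N.
  move=> h; have [ji|/ltnW ij] := leqP j i; first exact: h.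
  rewrite -opprB /gamma abszN -[RHS]h//.
  by apply: eq_Rintegral => x _; rewrite mulrC.
rewrite /autocorrelation -[RHS](Rintegral_mp (measure_preserving_iter j T_mp)).
  2: by apply: L2_mul => //; exact: L2_iter.
apply: eq_Rintegral => x _ /=.
by rewrite -iterD distnEl// subnK.
Qed.

Lemma sqr_norm_sumE N (c : nat -> R) (e : nat -> nat) :
  E (fun x => (\sum_(n < N) c n * f (iter (e n) T x)) ^+ 2) =
  toeplitz_form gamma N c (fun n => (e n)%:Z).
Proof.
pose t n m x := (c n * c m) * (f (iter (e n) T x) * f (iter (e m) T x)).
have Lt n m : L1 (t n m) by apply: L1Z; apply: L2_mul; exact: L2_iter.
transitivity (E (fun x => \sum_(n < N) \sum_(m < N) t n m x)).
  apply: eq_Rintegral => x _; rewrite expr2 mulr_suml; apply: eq_bigr => n _.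
  by rewrite mulr_sumr; apply: eq_bigr => m _; rewrite mulrACA.
rewrite (@Rintegral_sum _ _ _ mu N (fun n x => \sum_(m < N) t n m x)); last first.
  by move=> n; exact: L1_sum.
apply: eq_bigr => n _; rewrite (Rintegral_sum _ (Lt n)).
apply: eq_bigr => m _; rewrite RintegralZl//; last by apply: L2_mul; exact: L2_iter.
by rewrite autocorrelationE.
Qed.

(** The form is the squared norm of a combination of the [f \o T ^ n]. *)
Lemma autocorrelation_pd : positive_definite gamma.
Proof.
have Ef2 n : E (fun x => f (iter n T x) ^+ 2) = gamma 0.
  by under eq_Rintegral do rewrite expr2; rewrite autocorrelationE subrr.
split=> [j|j|N c]; first by rewrite /gamma abszN.
  have LfT := L2_iter `|j| fL2.
  apply: (le_trans (le_normr_Rintegral _ (L2_mul LfT fL2))) => //.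
  apply: (@le_trans _ _ (E (fun x => 2^-1 * (f (iter `|j| T x) ^+ 2 + f x ^+ 2)))).
    apply: le_Rintegral => //.
    - exact: (integrable_norm (L2_mul LfT fL2)).
    - by apply: L1Z; apply: L1D; [case: LfT|case: fL2].
    - move=> x _; set u := f _; set v := f x.
      have := sqr_ge0 (u + v); have := sqr_ge0 (u - v).
      rewrite sqrrB sqrrD ler_norml => *; apply/andP; split; lra.
  have [[_ Lf] [_ Lf']] := (LfT, fL2).
  rewrite RintegralZl//; last exact: L1D.
  rewrite RintegralD// Ef2 (Ef2 0%N); lra.
by rewrite -sqr_norm_sumE; apply: Rintegral_ge0 => x _; exact: sqr_ge0.
Qed.

(** The hypothesis of [weighted_form_cvg0] on the exponents [q * n] is the
    mean ergodic theorem for [T ^ q], where total ergodicity is used. *)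
Lemma real_weighted_average_cvg0 (k : nat) (a : nat -> R) (p : {poly int}) :
  (1 < k)%N -> kernel_automatic k a -> (1 < size p)%N ->
  (forall n : nat, 0 <= p.[n%:Z]) -> E f = 0 ->
  (fun N => E (fun x => (\sum_(n < N) N%:R^-1 * a n * f (iter `|p.[n%:Z]| T x)) ^+ 2))
    @ \oo --> (0 : R).
Proof.
move=> k1 ka sp p0 f0.
have -> : (fun N => E (fun x =>
      (\sum_(n < N) N%:R^-1 * a n * f (iter `|p.[n%:Z]| T x)) ^+ 2)) =
    (fun N => toeplitz_form gamma N (fun n => N%:R^-1 * a n) (fun n => p.[n%:Z])).
  apply/funext => N.
  rewrite (sqr_norm_sumE N (fun n => N%:R^-1 * a n) (fun n => `|p.[n%:Z]|%N)).
  by do 2![apply: eq_bigr => ? _]; rewrite !gez0_abs.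
apply: (weighted_form_cvg0 autocorrelation_pd k1 ka sp) => q q0.
have [_ Lf2] := fL2.
have := mean_ergodic (measure_preserving_iter q T_mp) (T_erg q0) (L2_L1 fL2) Lf2 f0.
have -> // : (fun M => toeplitz_form gamma M (fun=> M%:R^-1) (fun n => (q * n)%N%:Z)) =
  (fun n => E (fun x => (n%:R^-1 * ergodic_sum (iter q T) f n x) ^+ 2)).
apply/funext => M; rewrite -sqr_norm_sumE; apply: eq_Rintegral => x _.
rewrite /ergodic_sum mulr_sumr; congr (_ ^+ 2); apply: eq_bigr => n _.
by rewrite mulnC iterM.
Qed.

End RealWeightedAverages.

(** * Complex weights and complex observables *)

Section ComplexL2.
Context {R : realType} {d : measure_display} {X : measurableType d}.
Context (mu : probability X R).
Local Notation L1 g := (mu.-integrable [set: X] (EFin \o g))%classic.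
Local Notation L2 g := (measurable_fun [set: X]%classic g /\ L1 (fun x => g x ^+ 2)).
Local Notation E g := (\int[mu]_x g x)%R.

Lemma integral_powR2 (g : X -> R[i]) :
  (\int[mu]_x (`|(Normc.normc (g x))%:E| `^ 2))%E =
  (\int[mu]_x (Normc.normc (g x) ^+ 2)%:E)%E.
Proof.
apply: eq_integral => x _; rewrite /= ger0_norm ?normc_ge0//.
by rewrite powR_mulrn ?normc_ge0.
Qed.

Lemma inL2_components (g : X -> R[i]) : inL2 mu g ->
  L2 (fun x => complex.Re (g x)) /\ L2 (fun x => complex.Im (g x)).
Proof.
move=> [[mRe mIm] fin].
have Ln : L1 (fun x => Normc.normc (g x) ^+ 2).
  apply/integrableP; split.
    apply/measurable_EFinP; under eq_fun do rewrite sqr_normcE.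
    by apply: measurable_funD; exact: measurable_funX.
  move: fin; rewrite /L2norm => /(poweR_lty 2); rewrite poweR_Lnorm// integral_powR2.
  apply: le_lt_trans; rewrite le_eqVlt; apply/orP; left; apply/eqP.
  by apply: eq_integral => x _; rewrite /= ger0_norm ?sqr_ge0.
split; split=> //; apply: (L1_le _ Ln) => [|x]; try exact: measurable_funX.
  by rewrite ger0_norm ?sqr_ge0// sqr_normcE lerDl sqr_ge0.
by rewrite ger0_norm ?sqr_ge0// sqr_normcE lerDr sqr_ge0.
Qed.

Lemma cvgL2_mean_square (u : nat -> X -> R[i]) :
  (forall N, L1 (fun x => Normc.normc (u N x) ^+ 2)) ->
  ((fun N => E (fun x => Normc.normc (u N x) ^+ 2)) @ \oo --> (0 : R))%classic ->
  cvgL2 mu u (fun=> 0).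
Proof.
move=> Lu cvg0; rewrite /cvgL2.
have -> : (fun N => L2norm mu (fun x => u N x - 0)) =
    (fun N => (Num.sqrt (E (fun x => Normc.normc (u N x) ^+ 2)))%:E).
  apply/funext => N; rewrite /L2norm unlock.
  under [X in (X `^ _)%E]eq_integral do rewrite subr0.
  rewrite integral_powR2 -[X in (X `^ _)%E]fineK; last exact: integrable_fin_num (Lu N).
  rewrite poweR_EFin powR12_sqrt//; apply: Rintegral_ge0 => x _; exact: sqr_ge0.
apply: cvg_EFin; first exact: nearW.
rewrite -[X in (_ --> X)%classic]sqrtr0.
by apply: (continuous_cvg _ (@sqrt_continuous R 0)).
Qed.

(** Here [p - q] and [r + s] are the real and imaginary parts of a product of
    complex numbers. *)
Lemma sqr_normc_mul_le (p q r s : R) :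
  Normc.normc (Complex (p - q) (r + s)) ^+ 2 <=
  2 * (p ^+ 2 + q ^+ 2 + r ^+ 2 + s ^+ 2).
Proof.
rewrite sqr_normcE /=; have := sqr_ge0 (p + q); have := sqr_ge0 (r - s).
rewrite !sqrrB !sqrrD; lra.
Qed.

End ComplexL2.

(* The hypothesis on the values of [p] makes [absz] the identity on them. *)
Theorem theorem1 (R : realType) (a : nat -> R[i]) (ha : automatic a)
    (p : {poly int}) (p_nonconst : (1 < size p)%N)
    (p_ge0 : forall n : nat, 0 <= p.[n%:Z])
    (d : measure_display) (X : measurableType d) (mu : probability X R)
    (T : X -> X) (T_mp : measure_preserving mu T)
    (T_erg : totally_ergodic mu T)
    (f : X -> R[i]) (fL2 : inL2 mu f) (f_int0 : cintegral mu f = 0) :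
  cvgL2 mu
    (fun N x => average N (fun n => a n * f (iter (absz p.[n%:Z]) T x)))
    (fun=> 0).
Proof.
have [k [k1 ka]] := ha.
have [f1L2 f2L2] := inL2_components fL2.
have [f1_0 f2_0] : \int[mu]_x complex.Re (f x) = 0 /\ \int[mu]_x complex.Im (f x) = 0.
  by move: f_int0; rewrite /cintegral => -[-> ->].
have k1a := automatic_kernel (@complex.Re R) ka.
have k2a := automatic_kernel (@complex.Im R) ka.
(* The four averages of a component of [a] against a component of [f]. *)
pose r (b : nat -> R) (g : X -> R) N x : R :=
  \sum_(n < N) N%:R^-1 * b n * g (iter `|p.[n%:Z]| T x).
pose a1 n := complex.Re (a n); pose a2 n := complex.Im (a n).
pose f1 x := complex.Re (f x); pose f2 x := complex.Im (f x).
have avgE N x : average N (fun n => a n * f (iter `|p.[n%:Z]| T x)) =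
    Complex (r a1 f1 N x - r a2 f2 N x) (r a1 f2 N x + r a2 f1 N x).
  rewrite /average big_mkord mulr_sumr /r -sumrB -big_split /=.
  have cN : (N%:R : R[i])^-1 = real_complex R (N%:R^-1) by rewrite fmorphV rmorph_nat.
  apply/eqP; rewrite eq_complex /=; apply/andP; split; apply/eqP;
    rewrite raddf_sum; apply: eq_bigr => n _; rewrite cN /a1 /a2 /f1 /f2;
    case: (a n) => ? ?; case: (f _) => ? ? /=; ring.
have Lr b (g : X -> R) N := @L2_weighted_sum _ _ _ mu T T_mp g N
  (fun n => N%:R^-1 * b n) (fun n => `|p.[n%:Z]|%N).
have cvgr b g kb gL2 g0 :=
  @real_weighted_average_cvg0 R d X mu T T_mp T_erg g gL2 k b p k1 kb p_nonconst p_ge0 g0.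
pose bound N x := 2 * (r a1 f1 N x ^+ 2 + r a2 f2 N x ^+ 2 + r a1 f2 N x ^+ 2
  + r a2 f1 N x ^+ 2).
have Lsum N : mu.-integrable [set: X]%classic (EFin \o (fun x =>
    r a1 f1 N x ^+ 2 + r a2 f2 N x ^+ 2 + r a1 f2 N x ^+ 2 + r a2 f1 N x ^+ 2)).
  exact: L1D (L1D (L1D (Lr a1 f1 N f1L2).2 (Lr a2 f2 N f2L2).2)
    (Lr a1 f2 N f2L2).2) (Lr a2 f1 N f1L2).2.
have Lbound N : mu.-integrable [set: X]%classic (EFin \o bound N) by exact: L1Z.
have le_bound N x :
    Normc.normc (average N (fun n => a n * f (iter `|p.[n%:Z]| T x))) ^+ 2 <= bound N x.
  by rewrite avgE sqr_normc_mul_le.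
have Lavg N : mu.-integrable [set: X]%classic (EFin \o (fun x =>
    Normc.normc (average N (fun n => a n * f (iter `|p.[n%:Z]| T x))) ^+ 2)).
  apply: (L1_le _ (Lbound N)) => [|x]; last by rewrite ger0_norm ?sqr_ge0.
  under eq_fun do rewrite avgE sqr_normcE /=.
  apply: measurable_funD; apply: measurable_funX.
    exact: measurable_funB (Lr a1 f1 N f1L2).1 (Lr a2 f2 N f2L2).1.
  exact: measurable_funD (Lr a1 f2 N f2L2).1 (Lr a2 f1 N f1L2).1.
apply: cvgL2_mean_square => //.
apply: (@squeeze_cvgr _ _ _ _ (cst 0) (fun N => \int[mu]_x bound N x)).
- apply: nearW => N; apply/andP; split.
    by apply: Rintegral_ge0 => x _; exact: sqr_ge0.
  by apply: le_Rintegral => // x _; exact: le_bound.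
- exact: cvg_cst.
have -> : (fun N => \int[mu]_x bound N x) = (fun N => 2 *
   (\int[mu]_x (r a1 f1 N x ^+ 2) + \int[mu]_x (r a2 f2 N x ^+ 2) +
    \int[mu]_x (r a1 f2 N x ^+ 2) + \int[mu]_x (r a2 f1 N x ^+ 2))).
  apply/funext => N; rewrite RintegralZl//; congr (_ * _).
  have := (Lr a1 f1 N f1L2).2; have := (Lr a2 f2 N f2L2).2.
  have := (Lr a1 f2 N f2L2).2; have := (Lr a2 f1 N f1L2).2 => L21 L12 L22 L11.
  rewrite RintegralD//; last exact: L1D (L1D L11 L22) L12.
  by rewrite RintegralD//; [rewrite RintegralD|exact: L1D].
rewrite -[X in (_ --> X)%classic](mulr0 2) -[X in 2 * X]addr0 -[X in X + 0]addr0.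
rewrite -[X in X + 0 + 0]addr0.
apply: cvgMl_tmp.
exact: cvgD (cvgD (cvgD (cvgr a1 f1 k1a f1L2 f1_0) (cvgr a2 f2 k2a f2L2 f2_0))
  (cvgr a1 f2 k1a f2L2 f2_0)) (cvgr a2 f1 k2a f1L2 f1_0).
Qed.
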